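(* There exists a universal constant $C>0$ such that the following holds. Let $n\ge5$ and $r\ge2$ be integers and let $\varepsilon\in(0,1)$ be such that $$r\le\frac{\varepsilon\log n}{5\log\log n}.$$ Let $T\in(\mathbb R^n)^{\otimes r}$ be a random tensor with independent entries taking values in $[-1,1]$, and suppose that for some $L\ge1$ we have $\Pr(T_i\ne0)\le L\,n^{-1-\varepsilon}$ for all $i\in[n]^r$. Then $$\mathbb E\,\|T-\mathbb E T\|_{\mathrm{inj}}\le C\,\frac{L r^4}{\varepsilon}.$$ Moreover, for any $t>0$, $$\Pr\Big(\|T-\mathbb E T\|_{\mathrm{inj}}\ge C\,\frac{L r^3}{\varepsilon}(r+t)\Big)\le n^{-t}.$$
   Context: $[n]=\{1,\dots,n\}$; $\log$ is the natural logarithm; $\mathbb E T$ is the entrywise expectation. The injective norm of $T\in(\mathbb R^n)^{\otimes r}$ is $\|T\|_{\mathrm{inj}}=\max\{|\langle T,x_1\otimes\cdots\otimes x_r\rangle| : x_1,\dots,x_r\in\mathbb R^n,\ \|x_1\|_2=\dots=\|x_r\|_2=1\}$, where $\langle T,X\rangle=\sum_{i\in[n]^r}T_iX_i$. *)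

(* Defs.v *)
From HB Require Import structures.
From mathcomp Require Import all_boot all_order all_algebra.
From mathcomp Require Import all_classical all_reals all_analysis.
Set Implicit Arguments.
Unset Strict Implicit.
Unset Printing Implicit Defensive.
Import Order.TTheory GRing.Theory Num.Theory.
Import numFieldNormedType.Exports.
Local Open Scope classical_set_scope.
Local Open Scope ring_scope.

(* Multi-indices are functions 'I_r -> 'I_n; indices start at 0. *)
Definition tensor (R : realType) (n r : nat) := {ffun 'I_r -> 'I_n} -> R.

Definition tensor_dot (R : realType) (n r : nat) (T X : tensor R n r) : R :=
  \sum_(i : {ffun 'I_r -> 'I_n}) T i * X i.

Definition rank_one (R : realType) (n r : nat) (x : 'I_r -> 'rV[R]_n) :
    tensor R n r :=
  fun i => \prod_(k < r) x k 0 (i k).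

(* The library norm on 'rV[R]_n is the sup norm. *)
Definition euclidean_norm (R : realType) (n : nat) (x : 'rV[R]_n) : R :=
  Num.sqrt (\sum_(j < n) x 0 j ^+ 2).

(* For 0 < n the set below is nonempty and compact, so that its supremum is its
   maximum. *)
Definition injective_norm (R : realType) (n r : nat) (T : tensor R n r) : R :=
  sup [set `|tensor_dot T (rank_one x)| | x in
        [set x : 'I_r -> 'rV[R]_n | forall k, euclidean_norm (x k) = 1]].

Definition mutually_independent (d : measure_display) (Omega : measurableType d)
    (R : realType) (P : probability Omega R) (I : finType)
    (X : I -> {RV P >-> R}) : Prop :=
  forall (J : {set I}) (A : I -> set R), (forall i, measurable (A i)) ->
    P (\bigcap_(i in [set` J]) (X i @^-1` A i)) =
    (\prod_(i in J) P (X i @^-1` A i))%E.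

(* [fine] only casts to R: it loses nothing when the entries are integrable. *)
Definition centered (d : measure_display) (Omega : measurableType d)
    (R : realType) (P : probability Omega R) (n r : nat)
    (T : {ffun 'I_r -> 'I_n} -> {RV P >-> R}) (w : Omega) : tensor R n r :=
  fun i => T i w - fine 'E_P[T i].

(* Main.v *)
Require Import Defs.
From HB Require Import structures.
From mathcomp Require Import all_boot all_order all_algebra.
From mathcomp Require Import all_classical all_reals all_analysis.
From mathcomp Require Import measurable_realfun.
From mathcomp Require Import ring lra zify.
Import Order.TTheory GRing.Theory Num.Theory.
Import numFieldNormedType.Exports.
Import HBNNSimple.
Local Open Scope classical_set_scope.
Local Open Scope ring_scope.

Set Implicit Arguments.
Unset Strict Implicit.
Unset Printing Implicit Defensive.

(** Round the unit vectors to a grid of mesh [1 / net_size]; it remains to bound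
    [\sum_i T'_i \prod_k y_k(i_k)], [T' = T - E T], uniformly over grid vectors [y]
    of the unit ball. Put [u_k = |y_k(i_k)|] and [U = \prod_k u_k].

    If [u_k^2 < U] for some [k], then [U <= \prod_(l != k) u_l^2]. A line of the
    tensor carries [O((L + r + t) / eps)] nonzero entries, so these indices
    contribute at most [r] times that number, with no logarithmic loss.

    The other ("flat") indices are grouped by the dyadic scale [2^-a] of
    [min_k u_k]: there the weights are at most [4^-a], and the sum only sees the
    coordinates of [y] that are at least [2^-(a+1)]. If there are [s_a] of them, the
    number of choices is [n^O(r s_a)], and since the sparsity gives a factor
    [n^-eps], a Bennett-type bound makes the sum [O(4^-a (r s_a + r + t) / eps)].
    Because [\sum_j y_k(j)^2 <= 1], the series [\sum_a 4^-a s_a] is [O(r)], so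
    that summing over the scales costs no logarithm either. *)

(** * Lines of the tensor and sums of product weights *)

Section Fibers.
Variables (R : realType) (n r : nat).
Local Notation idx := {ffun 'I_r -> 'I_n}.

Definition fiber (i : idx) (k : 'I_r) (j : 'I_n) : idx :=
  [ffun l => if l == k then j else i l].

Definition weight (y : 'I_r -> 'I_n -> R) (i : idx) : R :=
  \prod_(k < r) y k (i k).

(** Exchanging [j] with the [k]-th coordinate of [i] is an involution on the pairs [(i, j)]. It
    turns [F (fiber i k j)] into [F i] and leaves [G] alone, so the second component becomes free
    and contributes the factor [n]. *)
Lemma sum_fiber (F G : idx -> R) (k : 'I_r) :
  (forall i j, G (fiber i k j) = G i) ->
  \sum_i G i * (\sum_j F (fiber i k j)) = n%:R * \sum_i F i * G i.
Proof.
move=> GE.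
pose h (p : idx * 'I_n) := (fiber p.1 k p.2, p.1 k).
have hK : involutive h.
  move=> [i j]; rewrite /h /=; congr pair; last by rewrite ffunE eqxx.
  by apply/ffunP => l; rewrite !ffunE; case: eqP => // ->.
under eq_bigr do rewrite mulr_sumr.
rewrite (pair_bigA _ (fun i j => G i * F (fiber i k j))) /=.
rewrite (reindex_inj (inv_inj hK)) /=.
rewrite (eq_bigr (fun p => F p.1 * G p.1)); last first.
  by move=> [i j] _ /=; rewrite GE mulrC; congr (F _ * _); have [] := hK (i, j).
rewrite -(pair_bigA _ (fun i (j : 'I_n) => F i * G i)) /= mulr_sumr.
by apply: eq_bigr => i _; rewrite sumr_const card_ord mulr_natl.
Qed.

Lemma sum_weight (y : 'I_r -> 'I_n -> R) :
  \sum_i weight y i = \prod_k \sum_j y k j.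
Proof. by rewrite bigA_distr_bigA. Qed.

(** Double counting over the lines in direction [k]: the product omits [k], hence is constant on
    each line, where [F] has mass at most [d]. The total of the products is at most [n], because
    coordinate [k] is free and the others sum to at most 1; this [n] cancels the one of
    [sum_fiber]. *)
Lemma sum_fiber_le (F : idx -> R) (d : R) (y : 'I_r -> 'I_n -> R) (k : 'I_r) :
  (0 < n)%N ->
  (forall i, 0 <= F i) -> (forall i, \sum_j F (fiber i k j) <= d) ->
  (forall l, \sum_j y l j ^+ 2 <= 1) ->
  \sum_i F i * \prod_(l < r | l != k) y l (i l) ^+ 2 <= d.
Proof.
move=> n0 F0 Fd y1.
pose G (i : idx) := \prod_(l < r | l != k) y l (i l) ^+ 2.
have G0 i : 0 <= G i by apply: prodr_ge0 => l _; exact: sqr_ge0.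
have GE i j : G (fiber i k j) = G i.
  by apply: eq_bigr => l /negPf lk; rewrite ffunE lk.
have n0R : 0 < n%:R :> R by rewrite ltr0n.
have i0 : idx := [ffun=> Ordinal n0].
have d0 : 0 <= d by apply: le_trans (Fd i0); apply: sumr_ge0.
have G1 : \sum_i G i <= n%:R.
  (* The missing factor is replaced by 1, so that the product is a full [weight] and its sum
     factorises. *)
  pose y' l j := if l == k then 1 else y l j ^+ 2.
  rewrite (eq_bigr (weight y')); last first.
    move=> i _; rewrite /weight (bigD1 k) //= /y' eqxx mul1r.
    by apply: eq_bigr => l /negPf ->.
  rewrite sum_weight (bigD1 k) //= {1}/y' eqxx sumr_const card_ord.
  rewrite -[leRHS]mulr1; apply: ler_wpM2l => //.
  apply: prodr_ile1 => l lk; rewrite /y' (negPf lk) y1 andbT.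
  by apply: sumr_ge0 => j _; exact: sqr_ge0.
rewrite -(ler_pM2l n0R) -(sum_fiber _ GE).
apply: (@le_trans _ _ (\sum_i G i * d)).
  by apply: ler_sum => i _; apply: ler_wpM2l.
by rewrite -mulr_suml ler_wpM2r.
Qed.

End Fibers.

(** * Dyadic levels *)

Section Levels.
Variables (R : realType) (A : nat).

(** Counting thresholds gives the [a] with [2^-(a+1) < u <= 2^-a] for [u] in [(2^-A, 1]]; everything
    at most [2^-A], zero included, gets the cap [A]. *)
Definition level (u : R) : nat := (\sum_(a < A) (u <= 2^-1 ^+ a.+1)%R)%N.

Lemma level_le u : (level u <= A)%N.
Proof.
rewrite /level -[leqRHS]muln1 -[X in (_ <= X * 1)%N]card_ord -sum_nat_const.
by apply: leq_sum => i _; exact: leq_b1.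
Qed.

(** The thresholds decrease, so those that [u] does not exceed form an initial segment of the
    indices. *)
Lemma levelP (u : R) (a : nat) : (a < A)%N ->
  (level u <= a)%N = (2^-1 ^+ a.+1 < u).
Proof.
have half b c : (b <= c)%N -> (2^-1 : R) ^+ c <= 2^-1 ^+ b.
  by move=> bc; apply: ler_wiXn2l => //; lra.
move=> aA; rewrite ltNge; case: leP => [ua|au].
  apply/negbTE; rewrite -ltnNge /level -(big_mkord xpredT (fun a => (u <= 2^-1 ^+ a.+1)%R : nat)).
  rewrite (@big_cat_nat _ _ _ a.+1) //= -[ltnLHS]addn0 -addSn leq_add //.
  rewrite big_nat (eq_bigr (fun=> 1%N)) => [|b /andP[_ ba]].
    by rewrite -big_nat sum_nat_const_nat subn0 muln1.
  by rewrite (le_trans ua (half _ _ _)).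
rewrite /level -(big_mkord xpredT (fun a => (u <= 2^-1 ^+ a.+1)%R : nat)).
rewrite (@big_cat_nat _ _ _ a) //=; last exact: ltnW.
rewrite [X in (_ + X)%N]big_nat [X in (_ + X)%N]big1 ?addn0 => [|b /andP[ab _]].
  rewrite -[leqRHS]muln1 -[X in (_ <= X * _)%N]subn0 -sum_nat_const_nat.
  by apply: leq_sum => i _; exact: leq_b1.
by rewrite leNgt (le_lt_trans (half _ _ _) au).
Qed.

Lemma le_level u : u <= 1 -> u <= 2^-1 ^+ level u.
Proof.
move=> u1; case E: (level u) => [|b]; first by rewrite expr0.
rewrite leNgt -levelP; first by rewrite E ltnn.
by rewrite -E level_le.
Qed.

(** Below the cap, [2^-(level+1) < u] gives the first term. At the cap, [4^-A <= 4 / n]; this second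
    term stays bounded when summed over [n] coordinates. *)
Lemma level_sqr (n : nat) u : (n < 4 ^ A.+1)%N -> (0 < n)%N ->
  4^-1 ^+ level u <= 4 * u ^+ 2 + 4 / n%:R.
Proof.
move=> nA n0; have n0R : 0 < n%:R :> R by rewrite ltr0n.
case: (ltnP (level u) A) => [lA|Al].
  have := leqnn (level u); rewrite {1}levelP // => lu.
  apply: (@le_trans _ _ (4 * u ^+ 2)); last by rewrite lerDl divr_ge0.
  have p0 : 0 <= (2^-1 : R) ^+ (level u).+1 by rewrite exprn_ge0 // invr_ge0.
  have -> : (4^-1 : R) ^+ level u = 4 * (2^-1 ^+ (level u).+1) ^+ 2.
    rewrite -exprM mulnC exprM exprS.
    have -> : (2^-1 : R) ^+ 2 = 4^-1 by field.
    by rewrite mulrA divff ?mul1r // pnatr_eq0.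
  by rewrite ler_pM2l // ler_pXn2r ?nnegrE //= ltW // (le_lt_trans p0).
have -> : level u = A by apply/eqP; rewrite eqn_leq level_le.
apply: (@le_trans _ _ (4 / n%:R)); last by rewrite lerDr mulr_ge0 ?sqr_ge0.
rewrite exprVn ler_pdivlMr // mulrC ler_pdivrMr ?exprn_gt0 //.
by rewrite -exprS -natrX ler_nat ltnW.
Qed.

Lemma sum_geom4 (l m : nat) :
  \sum_(a < m | (l <= a)%N) (4^-1 : R) ^+ a <= 4 / 3 * 4^-1 ^+ l.
Proof.
(* The induction needs the remaining tail on the right; [maxn] makes the bound 0 while the sum is
   still empty. *)
apply: (@le_trans _ _ (4 / 3 * (4^-1 ^+ l - 4^-1 ^+ (maxn l m)))); last first.
  by rewrite ler_pM2l ?divr_gt0 // lerBlDr lerDl exprn_ge0 // invr_ge0.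
elim: m => [|m IH]; first by rewrite big_ord0 maxn0 subrr mulr0.
rewrite big_mkcond big_ord_recr /= -big_mkcond /=.
case: leqP => [lm|ml].
  move: IH; rewrite (maxn_idPr lm) (maxn_idPr (leqW lm)) exprS => IH.
  apply: le_trans (lerD IH (lexx _)) _; lra.
by move: IH; rewrite (maxn_idPl (ltnW ml)) (maxn_idPl ml) addr0.
Qed.

Lemma sum_geom4_up (m : nat) : \sum_(a < m.+1) (4 : R) ^+ a <= 4 / 3 * 4 ^+ m.
Proof.
elim: m => [|m IH]; first by rewrite big_ord1 expr0; lra.
rewrite big_ord_recr /=; apply: le_trans (lerD IH (lexx _)) _.
rewrite exprS; lra.
Qed.

End Levels.

(** * Flat indices and scales *)

Section Zones.
Variables (R : realType) (n r A : nat).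
Local Notation idx := {ffun 'I_r -> 'I_n}.
Implicit Types (y : 'I_r -> 'I_n -> R) (i : idx).

Definition flat y i : bool := [forall k, `|weight y i| <= y k (i k) ^+ 2].

(** Levels decrease with size: this is the level of the smallest coordinate. *)
Definition tuple_level y i : nat := (\max_(k < r) level A `|y k (i k)|%R)%N.

Definition zone (a : nat) y i : bool := flat y i && (tuple_level y i == a).

Definition zone_weight (a : nat) y i : R :=
  if zone a y i then weight y i else 0.

Definition truncate (a : nat) y : 'I_r -> 'I_n -> R :=
  fun k j => if (level A `|y k j| <= a)%N then y k j else 0.

Definition nnz y : nat := (\sum_(k < r) \sum_(j < n) (y k j != 0%R))%N.

Lemma norm_weight y i : `|weight y i| = \prod_k `|y k (i k)|.
Proof. exact: normr_prod. Qed.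

(** Write [|weight y i| = u * q] with [u] the [k]-th factor. Then [u ^+ 2 < u * q] forces [u < q],
    so the weight is at most [q ^+ 2]. Summing over all [k] avoids choosing the failing one. *)
Lemma not_flat_weight y i : ~~ flat y i ->
  `|weight y i| <= \sum_k \prod_(l < r | l != k) y l (i l) ^+ 2.
Proof.
move=> /forallPn[k]; rewrite -ltNge => yk.
rewrite (bigD1 k) //=.
set Q := \prod_(l < r | _) _; set S := \sum_(k' < r | _) _.
have S0 : 0 <= S.
  by apply: sumr_ge0 => l _; apply: prodr_ge0 => m _; exact: sqr_ge0.
suff : `|weight y i| <= Q by lra.
move: yk; rewrite norm_weight (bigD1 k) //=.
set q := \prod_(l < r | _) _.
have q0 : 0 <= q by apply: prodr_ge0.
have -> : Q = q ^+ 2.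
  by rewrite /Q /q expr2 -big_split /=; apply: eq_bigr => l _; rewrite -expr2 real_normK ?num_real.
rewrite -[y k _ ^+ 2]real_normK ?num_real // expr2.
have := normr_ge0 (y k (i k)); rewrite le_eqVlt => /orP[/eqP <-|u0].
  by rewrite !mul0r ltxx.
rewrite ltr_pM2l // => uq; rewrite expr2.
by rewrite ler_wpM2r // ltW.
Qed.

Lemma sqr_weight_sum y : (forall k, \sum_j y k j ^+ 2 <= 1) ->
  \sum_i weight y i ^+ 2 <= 1.
Proof.
move=> y1; rewrite (eq_bigr (weight (fun k j => y k j ^+ 2))); last first.
  by move=> i _; rewrite /weight prodrXl.
rewrite sum_weight; apply: prodr_ile1 => k _; rewrite y1 andbT.
by apply: sumr_ge0 => j _; exact: sqr_ge0.
Qed.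

Lemma ball_le1 y k j : \sum_j y k j ^+ 2 <= 1 -> `|y k j| <= 1.
Proof.
move=> y1; rewrite -(@ler_pXn2r _ 2) ?nnegrE // expr1n real_normK ?num_real //.
apply: le_trans y1; rewrite (bigD1 j) //= lerDl.
by apply: sumr_ge0 => l _; exact: sqr_ge0.
Qed.

(** Flatness is applied at the coordinate that attains the maximal level [a], whose size is at most
    [2^-a]. *)
Lemma zone_weight_le a y i : (0 < r)%N -> (forall k, \sum_j y k j ^+ 2 <= 1) ->
  `|zone_weight a y i| <= 4^-1 ^+ a.
Proof.
move=> r0 y1; rewrite /zone_weight; case: ifP => [/andP[/forallP fl /eqP la]|_].
  have [k E] : {k : 'I_r | tuple_level y i = level A `|y k (i k)|}.
    by apply: bigop.eq_bigmax; rewrite card_ord.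
  apply: le_trans (fl k) _.
  rewrite -real_normK ?num_real // -la E.
  have -> : (4^-1 : R) = 2^-1 ^+ 2 by field.
  by rewrite -exprM mulnC exprM lerXn2r ?nnegrE ?exprn_ge0 ?invr_ge0 // le_level // ball_le1.
by rewrite normr0 exprn_ge0 // invr_ge0.
Qed.

Lemma zone_weight_sqr a y : (forall k, \sum_j y k j ^+ 2 <= 1) ->
  \sum_i zone_weight a y i ^+ 2 <= 1.
Proof.
move=> y1; apply: le_trans (sqr_weight_sum y1); apply: ler_sum => i _.
by rewrite /zone_weight; case: ifP => // _; rewrite expr0n sqr_ge0.
Qed.

(** A coordinate of level above [a] puts [i] outside the zone of [y] and makes the truncated weight
    vanish. Hence a zone sum depends only on the truncated vectors, and the union bound pays only
    for their nonzero entries. *)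
Lemma zone_weight_truncate a y i :
  zone_weight a (truncate a y) i = zone_weight a y i.
Proof.
have [/forallP la|/forallPn[k kl]] := boolP [forall k, (level A `|y k (i k)| <= a)%N].
  have E k : truncate a y k (i k) = y k (i k) by rewrite /truncate la.
  have Ew : weight (truncate a y) i = weight y i.
    by apply: eq_bigr => k _; rewrite E.
  rewrite /zone_weight /zone /flat /tuple_level Ew.
  by under eq_forallb do rewrite E; under eq_bigr do rewrite E.
have -> : zone_weight a (truncate a y) i = 0.
  rewrite /zone_weight; case: ifP => // _.
  by rewrite /weight (bigD1 k) //= /truncate (negPf kl) mul0r.
rewrite /zone_weight /zone; case: ifP => // /andP[_ /eqP la].
by case/negP: kl; rewrite -la; exact: bigop.leq_bigmax.
Qed.

Lemma truncate_sqr a y k : \sum_j truncate a y k j ^+ 2 <= \sum_j y k j ^+ 2.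
Proof.
by apply: ler_sum => j _; rewrite /truncate; case: ifP => // _; rewrite expr0n sqr_ge0.
Qed.

(** After exchanging the sums, an entry counts only from its own level on, so its geometric series
    is governed by [level_sqr]. For each [k] the total is at most [4/3 * (4 + 4) = 32/3 <= 11]. *)
Lemma sum_nnz_truncate y : (0 < n)%N -> (n < 4 ^ A.+1)%N ->
  (forall k, \sum_j y k j ^+ 2 <= 1) ->
  \sum_(a < A.+1) 4^-1 ^+ a * (nnz (truncate a y))%:R <= 11 * r%:R :> R.
Proof.
move=> n0 nA y1; have n0R : 0 < n%:R :> R by rewrite ltr0n.
apply: (@le_trans _ _ (\sum_(k < r) 11)); last first.
  by rewrite sumr_const card_ord mulr_natr.
under eq_bigr do rewrite /nnz natr_sum mulr_sumr.
rewrite exchange_big /=; apply: ler_sum => k _.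
under eq_bigr do rewrite natr_sum mulr_sumr.
rewrite exchange_big /=.
apply: (@le_trans _ _ (\sum_(j < n) (4 / 3 * (4 * y k j ^+ 2 + 4 / n%:R)))).
  apply: ler_sum => j _.
  apply: (@le_trans _ _ (4 / 3 * 4^-1 ^+ level A `|y k j|)); last first.
    by rewrite ler_pM2l // -(real_normK (num_real (y k j))) level_sqr.
  apply: le_trans (sum_geom4 R (level A `|y k j|) A.+1).
  rewrite [leRHS]big_mkcond /=; apply: ler_sum => a _; rewrite /truncate.
  have p0 : 0 <= (4^-1 : R) ^+ a by rewrite exprn_ge0 // invr_ge0.
  by case: ifP => _; [case: (_ != _); rewrite ?mulr1 ?mulr0|rewrite eqxx mulr0].
rewrite -mulr_sumr big_split /= -mulr_sumr sumr_const card_ord -[_ *+ n]mulr_natr.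
rewrite divfK ?gt_eqF //; have := y1 k; lra.
Qed.

Lemma sum_zones y (T : idx -> R) :
  \sum_(i | flat y i) T i * weight y i =
  \sum_(a < A.+1) \sum_i T i * zone_weight a y i.
Proof.
rewrite (partition_big (fun i => inord (tuple_level y i) : 'I_A.+1) xpredT) //=.
apply: eq_bigr => a _; rewrite big_mkcond; apply: eq_bigr => i _.
have lA : (tuple_level y i < A.+1)%N.
  by rewrite ltnS; apply/bigop.bigmax_leqP => k _; exact: level_le.
rewrite /zone_weight /zone -(inj_eq val_inj) /= inordK //.
by case: ifP; rewrite ?mulr0.
Qed.

(** The deterministic core: non-flat indices cost [d] per direction through [sum_fiber_le], flat
    ones are summed over the scales. The growing terms [ga * 4 ^+ a] are dominated by the last one,
    where [4 ^ A <= n]. *)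
Lemma tensor_sum_le (T F : idx -> R) y (d al be h ga : R) :
  (0 < n)%N -> (4 ^ A <= n < 4 ^ A.+1)%N ->
  0 <= al -> 0 <= be -> 0 <= h -> 0 <= ga ->
  (forall k, \sum_j y k j ^+ 2 <= 1) ->
  (forall i, `|T i| <= F i) ->
  (forall k i, \sum_j F (fiber i k j) <= d) ->
  (forall a : 'I_A.+1, `|\sum_i T i * zone_weight a (truncate a y) i| <=
     al * 4^-1 ^+ a * (be * (nnz (truncate a y))%:R + h) + ga * 4 ^+ a) ->
  `|\sum_i T i * weight y i| <=
    r%:R * d + al * (11 * be * r%:R + 4 / 3 * h) + 4 / 3 * ga * n%:R.
Proof.
move=> n0 /andP[An nA] al0 be0 h0 ga0 y1 TF Fd Z.
rewrite (bigID (flat y)) /= addrC -!addrA; apply: le_trans (ler_normD _ _) _.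
apply: lerD.
  apply: le_trans (ler_norm_sum _ _ _) _.
  apply: (@le_trans _ _ (\sum_i F i * \sum_k \prod_(l < r | l != k) y l (i l) ^+ 2)).
    rewrite big_mkcond; apply: ler_sum => i _; case: ifP => [fl|_].
      by rewrite normrM ler_pM // not_flat_weight.
    rewrite mulr_ge0 ?(le_trans _ (TF i)) //.
    by apply: sumr_ge0 => k _; apply: prodr_ge0 => l _; exact: sqr_ge0.
  under eq_bigr do rewrite mulr_sumr.
  rewrite exchange_big /=; apply: (@le_trans _ _ (\sum_(k < r) d)).
    apply: ler_sum => k _; apply: sum_fiber_le => // i.
    exact: le_trans (TF i).
  by rewrite sumr_const card_ord mulr_natl.
rewrite sum_zones; apply: le_trans (ler_norm_sum _ _ _) _.
apply: (@le_trans _ _ (\sum_(a < A.+1) (al * be * (4^-1 ^+ a * (nnz (truncate a y))%:R)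
   + al * h * 4^-1 ^+ a + ga * 4 ^+ a))).
  apply: ler_sum => a _.
  under eq_bigr do rewrite -zone_weight_truncate.
  apply: le_trans (Z a) _; rewrite le_eqVlt; apply/orP; left; apply/eqP; ring.
rewrite !big_split /= -!mulr_sumr; apply: lerD.
  apply: (@le_trans _ _ (al * be * (11 * r%:R) + al * h * (4 / 3))); [apply: lerD|].
  - by rewrite ler_wpM2l ?mulr_ge0 // sum_nnz_truncate.
  - rewrite ler_wpM2l ?mulr_ge0 //; have := @sum_geom4 R 0 A.+1.
    by rewrite expr0 mulr1.
  - rewrite le_eqVlt; apply/orP; left; apply/eqP; ring.
have -> : 4 / 3 * ga * n%:R = ga * (4 / 3 * n%:R) by ring.
rewrite ler_wpM2l //; apply: le_trans (sum_geom4_up _ _) _.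
by rewrite ler_pM2l // -natrX ler_nat.
Qed.

End Zones.

(** * The injective norm and its grid discretisation *)

Section InjectiveNorm.
Variables (R : realType) (n r : nat).
Local Notation idx := {ffun 'I_r -> 'I_n}.
Implicit Types (T : tensor R n r) (x : 'I_r -> 'rV[R]_n).

Lemma euclidean_norm1 (v : 'rV[R]_n) :
  euclidean_norm v = 1 -> \sum_j v 0 j ^+ 2 = 1.
Proof.
move=> /(congr1 (fun z => z ^+ 2)); rewrite expr1n sqr_sqrtr //.
by apply: sumr_ge0 => j _; exact: sqr_ge0.
Qed.

Lemma tensor_dotE T x : tensor_dot T (rank_one x) =
  \sum_i T i * weight (fun k j => x k 0 j) i.
Proof. by []. Qed.

Lemma norm_rank_one_le1 x i : (forall k, euclidean_norm (x k) = 1) ->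
  `|rank_one x i| <= 1.
Proof.
move=> x1; rewrite normr_prod; apply: prodr_ile1 => k _; rewrite normr_ge0 /=.
apply: (@ball_le1 _ _ _ (fun k j => x k 0 j)).
by rewrite (euclidean_norm1 (x1 k)).
Qed.

Lemma tensor_dot_le T x : (forall k, euclidean_norm (x k) = 1) ->
  `|tensor_dot T (rank_one x)| <= \sum_i `|T i|.
Proof.
move=> x1; apply: le_trans (ler_norm_sum _ _ _) _; apply: ler_sum => i _.
by rewrite normrM ler_piMr // norm_rank_one_le1.
Qed.

Lemma unit_vectors_exist : (0 < n)%N ->
  exists x : 'I_r -> 'rV[R]_n, forall k, euclidean_norm (x k) = 1.
Proof.
move=> n0; exists (fun _ => delta_mx 0 (Ordinal n0)) => k.
rewrite /euclidean_norm (bigD1 (Ordinal n0)) //= big1 ?addr0 => [|j /negPf jn].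
  by rewrite mxE !eqxx expr1n sqrtr1.
by rewrite mxE eqxx jn expr0n.
Qed.

Lemma injective_norm_le T (B : R) : (0 < n)%N ->
  (forall x, (forall k, euclidean_norm (x k) = 1) ->
    `|tensor_dot T (rank_one x)| <= B) -> injective_norm T <= B.
Proof.
move=> n0 TB; apply: ge_sup; last by move=> _ [x /= x1 <-]; exact: TB.
have [x x1] := unit_vectors_exist n0.
by exists `|tensor_dot T (rank_one x)|; exists x.
Qed.

Lemma le_injective_norm T x : (forall k, euclidean_norm (x k) = 1) ->
  `|tensor_dot T (rank_one x)| <= injective_norm T.
Proof.
move=> x1; apply: ub_le_sup; last by exists x.
by exists (\sum_i `|T i|) => _ [z /= z1 <-]; exact: tensor_dot_le.
Qed.

Lemma injective_norm_ge0 T : (0 < n)%N -> 0 <= injective_norm T.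
Proof.
by move=> /unit_vectors_exist[x x1]; exact: le_trans (le_injective_norm T x1).
Qed.

Lemma injective_norm_lipschitz T T' : (0 < n)%N ->
  injective_norm T <= injective_norm T' + \sum_i `|T i - T' i|.
Proof.
move=> n0; apply: injective_norm_le => // x x1.
have -> : tensor_dot T (rank_one x) =
    tensor_dot T' (rank_one x) + tensor_dot (fun i => T i - T' i) (rank_one x).
  by rewrite /tensor_dot -big_split /=; apply: eq_bigr => i _; ring.
apply: le_trans (ler_normD _ _) _.
by apply: lerD; [exact: le_injective_norm|exact: tensor_dot_le].
Qed.

End InjectiveNorm.

(** * Rounding to a finite grid *)

Section Grid.
Variables (R : realType).

(** The multiples of [1 / N] in [[-1, 1]]; the index [N] encodes 0. *)
Definition grid_point (N : nat) (z : 'I_N.*2.+1) : R := (z%:R - N%:R) / N%:R.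

(** Rounding is towards 0, so that rounded unit vectors stay in the unit ball. *)
Lemma grid_point_approx (N : nat) (v : R) : (0 < N)%N -> `|v| <= 1 ->
  exists z : 'I_N.*2.+1,
    `|grid_point z| <= `|v| /\ `|v - grid_point z| <= N%:R^-1.
Proof.
move=> N0 v1; have N0R : 0 < N%:R :> R by rewrite ltr0n.
have vN : 0 <= `|v| * N%:R by rewrite mulr_ge0.
pose m := Num.truncn (`|v| * N%:R).
have /andP[m1 m2] : m%:R <= `|v| * N%:R < m.+1%:R by exact: truncn_itv.
have mN : (m <= N)%N.
  rewrite -(ler_nat R); apply: le_trans m1 _.
  by rewrite -[leRHS]mul1r ler_wpM2r.
have g1 : m%:R / N%:R <= `|v| by rewrite ler_pdivrMr.
have g2 : `|v| - m%:R / N%:R <= N%:R^-1.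
  rewrite lerBlDl -[X in _ <= _ + X]mul1r -mulrDl ler_pdivlMr // ltW //.
  by rewrite natr1.
have g0 : 0 <= m%:R / N%:R :> R by rewrite divr_ge0.
case: (lerP 0 v) => v0.
  have zN : (N + m < N.*2.+1)%N by rewrite ltnS -addnn leq_add2l.
  exists (Ordinal zN).
  have -> : grid_point (Ordinal zN) = m%:R / N%:R.
    by rewrite /grid_point /= natrD; congr (_ / _); ring.
  rewrite (ger0_norm g0); split => //.
  by move: g1 g2; rewrite (ger0_norm v0) => g1 g2; rewrite ger0_norm // subr_ge0.
have zN : (N - m < N.*2.+1)%N by rewrite ltnS -addnn (leq_trans (leq_subr _ _)) // leq_addr.
exists (Ordinal zN).
have -> : grid_point (Ordinal zN) = - (m%:R / N%:R).
  by rewrite /grid_point /= natrB // -mulNr; congr (_ / _); ring.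
rewrite normrN (ger0_norm g0); split => //.
move: g1 g2; rewrite (ltr0_norm v0) => g1 g2.
by rewrite opprK ler0_norm; lra.
Qed.

(** Telescoping: the factors are replaced one at a time. *)
Lemma norm_prod_sub (I : Type) (s : seq I) (a b : I -> R) :
  (forall i, `|a i| <= 1) -> (forall i, `|b i| <= 1) ->
  `|\prod_(i <- s) a i - \prod_(i <- s) b i| <= \sum_(i <- s) `|a i - b i|.
Proof.
move=> a1 b1; elim: s => [|i s IH]; first by rewrite !big_nil subrr normr0.
rewrite !big_cons.
set pa := \prod_(j <- s) a j; set pb := \prod_(j <- s) b j.
have -> : a i * pa - b i * pb = a i * (pa - pb) + (a i - b i) * pb by ring.
rewrite addrC; apply: le_trans (ler_normD _ _) _; apply: lerD; rewrite normrM.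
  by rewrite ler_piMr // /pb normr_prod prodr_ile1 // => j _; rewrite normr_ge0 b1.
by apply: le_trans IH; rewrite ler_piMl.
Qed.

Variables (n r : nat).

(** Rounding changes a product of [r] factors by at most [r / net_size]. With [n ^ r] entries of
    size at most 2, the total error is exactly the 1 allowed in [injective_norm_grid]. *)
Definition net_size := (2 * r * n ^ r)%N.

Definition grid_vectors (s : {ffun 'I_r -> {ffun 'I_n -> 'I_net_size.*2.+1}}) :
  'I_r -> 'I_n -> R := fun k j => grid_point (s k j).

Lemma injective_norm_grid (T : tensor R n r) (B : R) :
  (0 < n)%N -> (0 < r)%N -> (forall i, `|T i| <= 2) ->
  (forall s, (forall k, \sum_j grid_vectors s k j ^+ 2 <= 1) ->
    `|\sum_i T i * weight (grid_vectors s) i| <= B) ->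
  injective_norm T <= B + 1.
Proof.
move=> n0 r0 T2 TB; apply: injective_norm_le => // x x1.
have xs k : \sum_j x k 0 j ^+ 2 = 1 by exact: euclidean_norm1 (x1 k).
have xle k j : `|x k 0 j| <= 1.
  by apply: (@ball_le1 _ _ _ (fun k j => x k 0 j)); rewrite xs.
have N0 : (0 < net_size)%N by rewrite /net_size !muln_gt0 expn_gt0 n0 r0.
pose z k j := projT1 (cid (grid_point_approx N0 (xle k j))).
have zP k j : `|grid_point (z k j)| <= `|x k 0 j| /\
    `|x k 0 j - grid_point (z k j)| <= net_size%:R^-1.
  by rewrite /z; case: cid.
pose s : {ffun 'I_r -> {ffun 'I_n -> 'I_net_size.*2.+1}} := [ffun k => [ffun j => z k j]].
have sE k j : grid_vectors s k j = grid_point (z k j) by rewrite /grid_vectors !ffunE.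
have s1 k : \sum_j grid_vectors s k j ^+ 2 <= 1.
  rewrite -(xs k); apply: ler_sum => j _; rewrite sE.
  rewrite -(real_normK (num_real (grid_point _))) -(real_normK (num_real (x k 0 j))).
  by rewrite lerXn2r ?nnegrE // (zP k j).1.
rewrite tensor_dotE.
have -> : \sum_i T i * weight (fun k j => x k 0 j) i =
    \sum_i T i * weight (grid_vectors s) i +
    \sum_i T i * (weight (fun k j => x k 0 j) i - weight (grid_vectors s) i).
  by rewrite -big_split /=; apply: eq_bigr => i _; ring.
apply: le_trans (ler_normD _ _) _; apply: lerD; first exact: TB.
apply: le_trans (ler_norm_sum _ _ _) _.
apply: (@le_trans _ _ (\sum_(i : {ffun 'I_r -> 'I_n}) (2 * (r%:R / net_size%:R)))).
  apply: ler_sum => i _; rewrite normrM; apply: ler_pM => //.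
  rewrite /weight; apply: le_trans (norm_prod_sub _ _ _) _ => [k|k|]; first exact: xle.
    by apply: (@ball_le1 R n r); exact: s1.
  apply: (@le_trans _ _ (\sum_(k < r) net_size%:R^-1)).
    by apply: ler_sum => k _; rewrite sE (zP k _).2.
  by rewrite sumr_const card_ord mulr_natl.
rewrite sumr_const card_ffun !card_ord -[leLHS]mulr_natr /net_size.
rewrite le_eqVlt; apply/orP; left; apply/eqP.
rewrite !natrM natrX; field.
by rewrite -natrX !pnatr_eq0 -!lt0n expn_gt0 n0 r0.
Qed.

End Grid.

(** * Independence *)

Section Independence.
Context d (Omega : measurableType d) (R : realType) (P : probability Omega R).

(** From indicators to simple functions, by linearity over the finite range of [f]. *)
Lemma integral_mul_nnsfun (G : Omega -> R) (X : {RV P >-> R}) (c : R)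
    (f : {nnsfun R >-> R}) :
  measurable_fun setT G -> (forall w, 0 <= G w) -> 0 <= c ->
  (forall A : set R, measurable A ->
    (\int[P]_w (G w * \1_A (X w))%:E = c%:E * \int[P]_w (\1_A (X w))%:E)%E) ->
  (\int[P]_w (G w * f (X w))%:E = c%:E * \int[P]_w (f (X w))%:E)%E.
Proof.
move=> mG G0 c0 GA.
have mI (y : R) : measurable (f @^-1` [set y]) by exact: measurable_sfunP.
have fI (y : R) : measurable_fun setT (fun w => \1_(f @^-1` [set y]) (X w) : R).
  exact: (measurableT_comp (measurable_indic (mI y))).
have EF (y : R) : range f y -> 0 <= y.
  by move=> [x _ <-].
(* [max y 0 = y] on the range of [f]; the maximum makes every summand nonnegative,
   as [ge0_integral_fsum] asks for all indices. *)
transitivity (\int[P]_w (\sum_(y \in range f)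
    (Order.max y 0 * (G w * \1_(f @^-1` [set y]) (X w)))%:E))%E.
  apply: eq_integral => w _; rewrite fsumEFin //; congr EFin.
  rewrite fimfunE mulr_fsumr; apply: eq_fsbigr => y /set_mem yf.
  by rewrite max_l; [exact: mulrCA|exact: EF].
rewrite ge0_integral_fsum //; last 2 first.
- move=> y; apply/measurable_EFinP; apply: measurable_funM => //.
  exact: measurable_funM.
- by move=> y w _; rewrite lee_fin !mulr_ge0 // le_max lexx orbT.
transitivity (c%:E * \sum_(y \in range f)
    \int[P]_w (Order.max y 0 * \1_(f @^-1` [set y]) (X w))%:E)%E.
  rewrite ge0_mule_fsumr; last first.
    by move=> y; apply: integral_ge0 => w _; rewrite lee_fin mulr_ge0 // le_max lexx orbT.
  apply: eq_fsbigr => y /set_mem yf.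
  have m0 : 0 <= Order.max y 0 by rewrite le_max lexx orbT.
  under eq_integral do rewrite EFinM.
  rewrite ge0_integralZl_EFin //; last 2 first.
  - by move=> w _; rewrite lee_fin mulr_ge0.
  - by apply/measurable_EFinP; exact: measurable_funM.
  under [in RHS]eq_integral do rewrite EFinM.
  rewrite ge0_integralZl_EFin //; last exact/measurable_EFinP.
  by rewrite GA // muleCA.
congr (_ * _)%E.
rewrite -ge0_integral_fsum //; last 2 first.
- by move=> y; apply/measurable_EFinP; apply: measurable_funM.
- by move=> y w _; rewrite lee_fin mulr_ge0 // le_max lexx orbT.
apply: eq_integral => w _; rewrite fsumEFin //; congr EFin.
rewrite [RHS]fimfunE; apply: eq_fsbigr => y /set_mem yf.
by rewrite max_l // EF.
Qed.

(** From simple to nonnegative measurable functions, by monotone convergence on both sides. *)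
Lemma integral_mul_measurable (G : Omega -> R) (X : {RV P >-> R}) (c : R)
    (f : R -> R) :
  measurable_fun setT G -> (forall w, 0 <= G w) -> 0 <= c ->
  measurable_fun setT f -> (forall x, 0 <= f x) ->
  (forall A : set R, measurable A ->
    (\int[P]_w (G w * \1_A (X w))%:E = c%:E * \int[P]_w (\1_A (X w))%:E)%E) ->
  (\int[P]_w (G w * f (X w))%:E = c%:E * \int[P]_w (f (X w))%:E)%E.
Proof.
move=> mG G0 c0 mf f0 GA.
have mf' : measurable_fun setT (EFin \o f) by exact/measurable_EFinP.
pose phi m : {nnsfun R >-> R} := nnsfun_approx measurableT mf' m.
have cphi x : (phi m x)%:E @[m --> \oo] --> (f x)%:E.
  by apply: (cvg_nnsfun_approx measurableT mf') => // y _; rewrite lee_fin.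
have ndphi x : {homo phi^~ x : m p / (m <= p)%N >-> m <= p}.
  by move=> m p mp; have /lefP := nd_nnsfun_approx measurableT mf' mp; exact.
have mphi m : measurable_fun setT (fun w => phi m (X w)).
  exact: measurableT_comp.
transitivity (\int[P]_w limn (fun m => (G w * phi m (X w))%:E))%E.
  apply: eq_integral => w _; apply/esym/cvg_lim => //.
  under eq_fun do rewrite EFinM.
  by rewrite EFinM; apply: cvgeZl.
rewrite monotone_convergence //; last 3 first.
- by move=> m; apply/measurable_EFinP; exact: measurable_funM.
- by move=> m w _; rewrite lee_fin mulr_ge0.
- by move=> w _ m p mp; rewrite lee_fin ler_wpM2l // ndphi.
transitivity (limn (fun m => c%:E * \int[P]_w (phi m (X w))%:E))%E.
  by congr (limn _); apply/funext => m; exact: integral_mul_nnsfun.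
apply/cvg_lim => //; apply: cvgeZl => //.
have -> : (\int[P]_w (f (X w))%:E)%E = (\int[P]_w limn (fun m => (phi m (X w))%:E))%E.
  by apply: eq_integral => w _; apply/esym/cvg_lim.
apply: cvg_monotone_convergence => //.
- by move=> m; exact/measurable_EFinP.
- by move=> m w _; rewrite lee_fin.
- by move=> w _ m p mp; rewrite lee_fin ndphi.
Qed.

Variables (I : finType) (X : I -> {RV P >-> R}).
Hypothesis Xind : mutually_independent X.

Lemma integral_indic_comp (Y : {RV P >-> R}) (A : set R) : measurable A ->
  (\int[P]_w (\1_A (Y w))%:E = P (Y @^-1` A))%E.
Proof.
move=> mA; have -> : (fun w => (\1_A (Y w))%:E) = (fun w => (\1_(Y @^-1` A) w)%:E :> \bar R).
  by [].
by rewrite integral_indic ?setIT // -[X in measurable X]setTI; exact: measurable_funPT.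
Qed.

(** Induction on a list [S] of the indices at which [g i] may be other than an indicator. For empty
    [S] this is the definition of independence; each step frees one more index with
    [integral_mul_measurable]. *)
Lemma independent_integral_prod_aux (S : seq I) (g : I -> R -> R) (e : I -> R) :
  (forall i, i \notin S -> exists2 A : set R, measurable A & g i = \1_A) ->
  (forall i, measurable_fun setT (g i)) -> (forall i x, 0 <= g i x) ->
  (forall i, \int[P]_w (g i (X i w))%:E = (e i)%:E)%E ->
  (\int[P]_w (\prod_i g i (X i w))%:E = (\prod_i e i)%:E)%E.
Proof.
elim: S g e => [|j S IH] g e gS mg g0 ge.
  pose A i := projT1 (cid2 (gS i isT)).
  have mA i : measurable (A i) by rewrite /A; case: cid2.
  have gA i : g i = \1_(A i) by rewrite /A; case: cid2.
  have XA i : P (X i @^-1` A i) = (e i)%:E by rewrite -ge gA integral_indic_comp.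
  have mXA i : measurable (X i @^-1` A i).
    by rewrite -[X in measurable X]setTI; exact: measurable_funPT.
  transitivity (P (\bigcap_(i in [set` [set: I]%SET]) (X i @^-1` A i))).
    rewrite -[X in P X]setIT -integral_indic //; last first.
      by apply: fin_bigcap_measurable => // i _.
    apply: eq_integral => w _; congr EFin.
    rewrite /indic; have [wA|wA] := boolP (w \in _).
      rewrite big1 // => i _; rewrite gA /indic mem_set //.
      by have /set_mem := wA; apply; rewrite /= finset.in_setT.
    have [i iA] : exists i, ~ A i (X i w).
      apply/existsNP => h; move/negP: wA; apply; apply/mem_set => i _; exact: h.
    by rewrite (bigD1 i) //= gA /indic memNset // mul0r.
  rewrite (Xind _ mA) -prodEFin; apply: eq_big => i; [by rewrite finset.in_setT|by rewrite XA].
have e0 i : 0 <= e i.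
  by rewrite -lee_fin -ge; apply: integral_ge0 => w _; rewrite lee_fin.
have mgX i : measurable_fun setT (fun w => g i (X i w)).
  exact: measurableT_comp.
rewrite (bigD1 j) //= mulrC EFinM -(ge j).
transitivity (\int[P]_w ((\prod_(i | i != j) g i (X i w)) * g j (X j w))%:E)%E.
  by apply: eq_integral => w _; rewrite (bigD1 j) //= mulrC.
apply: integral_mul_measurable => //.
- have -> : (fun w => \prod_(i | i != j) g i (X i w)) =
      (fun w => \prod_i (if i != j then g i (X i w) else 1)).
    by apply/funext => w; rewrite big_mkcond.
  apply: measurable_prod => i _; case: (i != j) => //; exact: measurable_cst.
- by move=> w; apply: prodr_ge0.
- by apply: prodr_ge0.
(* With [\1_A] in place of [g j], index [j] can leave the list and the induction hypothesis
   applies. *)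
move=> A mA.
pose g' i := if i == j then \1_A else g i.
pose e' i := if i == j then fine (P (X j @^-1` A)) else e i.
have eE : \prod_i e' i = fine (P (X j @^-1` A)) * \prod_(i | i != j) e i.
  rewrite (bigD1 j) //= {1}/e' eqxx; congr (_ * _).
  by apply: eq_bigr => i /negPf ij; rewrite /e' ij.
transitivity (\int[P]_w (\prod_i g' i (X i w))%:E)%E.
  apply: eq_integral => w _; rewrite [in RHS](bigD1 j) //= {1}/g' eqxx mulrC.
  by congr (_ * _)%:E; apply: eq_bigr => i /negPf ij; rewrite /g' ij.
rewrite (IH g' e').
- rewrite eE mulrC EFinM fineK ?integral_indic_comp //.
  by rewrite fin_num_measure // -[X in measurable X]setTI; exact: measurable_funPT.
- move=> i iS; rewrite /g'; case: (eqVneq i j) => [_|ij]; first by exists A.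
  by apply: gS; rewrite inE negb_or ij.
- by move=> i; rewrite /g'; case: ifP => // _; exact: measurable_indic.
- by move=> i x; rewrite /g'; case: ifP => // _.
move=> i; rewrite /g' /e'; case: (eqVneq i j) => [->|ij]; last exact: ge.
rewrite integral_indic_comp // fineK //.
by rewrite fin_num_measure // -[X in measurable X]setTI; exact: measurable_funPT.
Qed.

Lemma independent_integral_prod (g : I -> R -> R) (e : I -> R) :
  (forall i, measurable_fun setT (g i)) -> (forall i x, 0 <= g i x) ->
  (forall i, \int[P]_w (g i (X i w))%:E = (e i)%:E)%E ->
  (\int[P]_w (\prod_i g i (X i w))%:E = (\prod_i e i)%:E)%E.
Proof.
by apply: (@independent_integral_prod_aux (enum I)) => i; rewrite mem_enum.
Qed.

End Independence.

(** * Exponential moments *)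

Section MomentGenerating.
Context d (Omega : measurableType d) (R : realType) (P : probability Omega R).

(** For [z >= 0], use [e^z - 1 <= z e^z] twice. For [z < 0], the second use is replaced by
    [1 + z <= e^z] multiplied by the negative [z]. *)
Lemma expR_le_sqr (z : R) : expR z <= 1 + z + z ^+ 2 * expR `|z|.
Proof.
have e0 := expR_gt0 z.
have h1 : expR z - 1 <= z * expR z.
  have := expR_ge1Dx (- z); rewrite expRN -(ler_pM2l e0) divff ?gt_eqF //; lra.
have h2 := expR_ge1Dx z.
have [z0|z0] := lerP 0 z.
  rewrite (ger0_norm z0) expr2; have := ler_wpM2l z0 h1; lra.
have h3 : 1 <= expR `|z| by have := expR_ge1Dx `|z|; have := normr_ge0 z; lra.
have h4 : z * (expR z - 1) <= z * z by apply: ler_wnM2l; [exact: ltW|lra].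
have := ler_wpM2l (sqr_ge0 z) h3; rewrite expr2; lra.
Qed.

Lemma bounded_integrable (f : Omega -> R) (B : R) :
  measurable_fun setT f -> (forall w, `|f w| <= B) ->
  P.-integrable setT (EFin \o f).
Proof.
move=> mf fB; apply: measurable_bounded_integrable => //.
  by apply: le_lt_trans (probability_le1 _ _) _ => //; exact: ltry.
exists B; split; first exact: num_real.
by move=> x Bx w _ /=; exact: le_trans (fB w) (ltW Bx).
Qed.

Lemma measurable_nonzero (X : {RV P >-> R}) : measurable [set w | X w <> 0].
Proof.
have -> : [set w | X w <> 0] = X @^-1` (~` [set 0]) by [].
by rewrite -[X in measurable X]setTI; apply: measurable_funPT => //; exact: measurableC.
Qed.

Lemma integral_affine (X : Omega -> R) (S : set Omega) (a b c m : R) :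
  P.-integrable setT (EFin \o X) -> measurable S ->
  (\int[P]_w (X w)%:E = m%:E)%E ->
  (\int[P]_w (a + b * X w + c * \1_S w)%:E = (a + b * m + c * fine (P S))%:E)%E.
Proof.
move=> iX mS Xm.
have iS : P.-integrable setT (fun w => (\1_S w)%:E) by exact: integrable_indic.
have ia : P.-integrable setT (fun w => a%:E) by exact: finite_measure_integrable_cst.
have ib : P.-integrable setT (fun w => b%:E * (X w)%:E)%E by exact: integrableZl.
have ic : P.-integrable setT (fun w => c%:E * (\1_S w)%:E)%E by exact: integrableZl.
transitivity (\int[P]_w ((a%:E + b%:E * (X w)%:E) + c%:E * (\1_S w)%:E))%E; first by [].
rewrite integralD //; last exact: integrableD.
rewrite integralD // integral_cst // !integralZl // integral_indic // setIT Xm.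
by rewrite [X in (_ * X)%E]probability_setT mule1 !EFinD !EFinM fineK // fin_num_measure.
Qed.

Variable X : {RV P >-> R}.
Hypothesis X1 : forall w, -1 <= X w <= 1.

Let S := [set w | X w <> 0].

Lemma bounded_rv_integrable : P.-integrable setT (EFin \o X).
Proof.
apply: (@bounded_integrable _ 1); first exact: measurable_funPT.
by move=> w; rewrite ler_norml X1.
Qed.

Lemma integral_rvE : (\int[P]_w (X w)%:E = (fine 'E_P[X])%:E)%E.
Proof.
by rewrite expectation_def fineK //; apply: integrable_fin_num => //; exact: bounded_rv_integrable.
Qed.

Lemma norm_rv_le w : `|X w| <= \1_S w.
Proof.
rewrite /indic; have [->|Xw] := pselect (X w = 0); first by rewrite normr0.
by rewrite mem_set // ler_norml X1.
Qed.

Lemma norm_expectation_le : `|fine 'E_P[X]| <= fine (P S).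
Proof.
have mS : measurable S by exact: measurable_nonzero.
rewrite -lee_fin -abse_EFin -integral_rvE; apply: le_trans (le_abse_integral _ _ _) _ => //.
  by apply/measurable_EFinP; exact: measurable_funPT.
rewrite fineK ?fin_num_measure // -[S]setIT -integral_indic //.
apply: ge0_le_integral => //.
- by apply: measurableT_comp => //; apply/measurable_EFinP; exact: measurable_funPT.
- by apply/measurable_EFinP; exact: measurable_indic.
by move=> w _; rewrite lee_fin norm_rv_le.
Qed.

(** Bennett-type estimate. With [q = P S] and [|m| <= q], one has [(X - m)^2 <= 2 * \1_S + 2 * q^2],
    so [expR_le_sqr] yields a pointwise bound affine in [X] and [\1_S]. Its linear part has mean
    zero, and [q^2 + q <= 2 * p] leaves a variance proportional to [p]. *)
Lemma mgf_centered (c lam M p : R) : 0 <= lam -> `|c| <= M -> (P S <= p%:E)%E ->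
  (\int[P]_w (expR (lam * (c * (X w - fine 'E_P[X]))))%:E <=
   (expR (4 * p * (lam * c) ^+ 2 * expR (2 * lam * M)))%:E)%E.
Proof.
move=> lam0 cM Sp.
have mS : measurable S by exact: measurable_nonzero.
set m := fine _; set q := fine (P S).
have q0 : 0 <= q by exact: fine_ge0.
have qE : P S = q%:E by rewrite fineK // fin_num_measure.
have qp : q <= p by rewrite -lee_fin -qE.
have q1 : q <= 1 by rewrite -lee_fin -qE probability_le1.
have mq : `|m| <= q by exact: norm_expectation_le.
set K := expR (2 * lam * M); have K0 : 0 < K := expR_gt0 _.
set L2 := (lam * c) ^+ 2; have L20 : 0 <= L2 := sqr_ge0 _.
pose a := 1 - lam * c * m + 2 * L2 * q ^+ 2 * K.
have m2 : m ^+ 2 <= q ^+ 2 by rewrite -real_normK ?num_real // lerXn2r ?nnegrE.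
have pw w : expR (lam * (c * (X w - m))) <= a + (lam * c) * X w + (2 * L2 * K) * \1_S w.
  set z := lam * (c * (X w - m)).
  have zM : `|z| <= 2 * lam * M.
    rewrite /z normrM (ger0_norm lam0) normrM.
    have -> : 2 * lam * M = lam * (M * 2) by ring.
    rewrite ler_wpM2l // ler_pM //; apply: le_trans (ler_normB _ _) _.
    have : `|X w| <= 1 by rewrite ler_norml X1.
    lra.
  apply: le_trans (expR_le_sqr z) _.
  have z2 : z ^+ 2 <= L2 * (2 * \1_S w + 2 * q ^+ 2).
    have -> : z ^+ 2 = L2 * (X w - m) ^+ 2 by rewrite /z /L2; ring.
    rewrite ler_wpM2l //.
    have x2 : X w ^+ 2 <= \1_S w.
      rewrite -real_normK ?num_real // expr2; apply: le_trans (norm_rv_le w).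
      by rewrite ler_piMr // ler_norml X1.
    have := sqr_ge0 (X w + m); move: m2 x2; rewrite !expr2; nra.
  have Kz : expR `|z| <= K by rewrite ler_expR.
  have : z ^+ 2 * expR `|z| <= L2 * (2 * \1_S w + 2 * q ^+ 2) * K.
    by rewrite ler_pM ?sqr_ge0 ?expR_ge0.
  have zE : z = lam * c * X w - lam * c * m by rewrite /z; ring.
  rewrite /a; lra.
apply: (@le_trans _ _ (\int[P]_w (a + (lam * c) * X w + (2 * L2 * K) * \1_S w)%:E)%E).
  have mX : measurable_fun setT X by exact: measurable_funPT.
  have m1 : measurable_fun setT (\1_S : Omega -> R) by exact: measurable_indic.
  apply: ge0_le_integral => //.
  - apply/measurable_EFinP; apply: measurableT_comp; first exact: measurable_expR.
    apply: measurable_funM => //; apply: measurable_funM => //.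
    exact: measurable_funB.
  - apply/measurable_EFinP; apply: measurable_funD; last exact: measurable_funM.
    by apply: measurable_funD => //; exact: measurable_funM.
  - by move=> w _; rewrite lee_fin pw.
rewrite (integral_affine _ _ _ bounded_rv_integrable mS integral_rvE) -/m -/q lee_fin.
apply: le_trans (expR_ge1Dx _).
have : 2 * L2 * K * (q ^+ 2 + q) <= 2 * L2 * K * (2 * p).
  have q2 : q ^+ 2 <= q by rewrite expr2 ler_piMr.
  have k0 : 0 <= 2 * L2 * K by rewrite mulr_ge0 ?(ltW K0) // mulr_ge0.
  apply: ler_wpM2l => //; lra.
rewrite /a; lra.
Qed.

Lemma mgf_nonzero (lam p : R) : 0 <= lam -> (P S <= p%:E)%E ->
  (\int[P]_w (expR (lam * (X w != 0)%:R))%:E <= (expR (p * expR lam))%:E)%E.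
Proof.
move=> lam0 Sp.
have mS : measurable S by exact: measurable_nonzero.
have qE : P S = (fine (P S))%:E by rewrite fineK // fin_num_measure.
have qp : fine (P S) <= p by rewrite -lee_fin -qE.
have SE w : (X w != 0)%:R = \1_S w :> R.
  rewrite /indic; congr (_%:R); congr nat_of_bool; apply/idP/idP => [/eqP h|/set_mem /eqP //].
  exact/mem_set.
under eq_integral do rewrite SE.
(* The zero coefficient of [X] brings the bound into the form of [integral_affine]. *)
apply: (@le_trans _ _ (\int[P]_w (1 + 0 * X w + expR lam * \1_S w)%:E)%E).
  have m1 : measurable_fun setT (\1_S : Omega -> R) by exact: measurable_indic.
  apply: ge0_le_integral => //.
  - apply/measurable_EFinP; apply: measurableT_comp; first exact: measurable_expR.
    exact: measurable_funM.
  - apply/measurable_EFinP; apply: measurable_funD; last exact: measurable_funM.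
    by apply: measurable_funD => //; apply: measurable_funM => //; exact: measurable_funPT.
  - move=> w _; rewrite lee_fin mul0r addr0 /indic; have := expR_gt0 lam.
    case: (_ \in _) => /=; rewrite ?mulr1 ?mulr0 ?expR0 ?addr0 //; lra.
rewrite (integral_affine _ _ _ bounded_rv_integrable mS integral_rvE) lee_fin mul0r addr0.
apply: le_trans (expR_ge1Dx _); rewrite lerD2l mulrC ler_wpM2r //; exact: expR_ge0.
Qed.

End MomentGenerating.

(** * Chernoff bound for independent sums *)

Section Chernoff.
Context d (Omega : measurableType d) (R : realType) (P : probability Omega R).
Variables (I : finType) (X : I -> {RV P >-> R}).
Hypothesis Xind : mutually_independent X.

Lemma measurable_sum_comp (h : I -> R -> R) :
  (forall i, measurable_fun setT (h i)) ->
  measurable_fun setT (fun w => \sum_i h i (X i w)).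
Proof.
by move=> mh; apply: measurable_sum => i; apply: measurableT_comp => //; exact: measurable_funPT.
Qed.

Lemma measurable_ge_sum (h : I -> R -> R) (D : R) :
  (forall i, measurable_fun setT (h i)) ->
  measurable [set w | D <= \sum_i h i (X i w)].
Proof.
move=> mh; have -> : [set w | D <= \sum_i h i (X i w)] =
    (fun w => \sum_i h i (X i w)) @^-1` `[D, +oo[%classic.
  by apply/seteqP; split => w /=; rewrite in_itv /= andbT.
by rewrite -[X in measurable X]setTI; apply: measurable_sum_comp.
Qed.

(** Markov's inequality for the exponential of the sum, whose mean factorises by independence. The
    exponential parameter is absorbed into [h] and [D]. *)
Lemma chernoff_sum (h : I -> R -> R) (b : I -> R) (D : R) :
  (forall i, measurable_fun setT (h i)) ->
  (forall i, (\int[P]_w (expR (h i (X i w)))%:E <= (expR (b i))%:E)%E) ->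
  (P [set w | (D <= \sum_i h i (X i w))%R] <= (expR (\sum_i b i - D))%:E)%E.
Proof.
move=> mh hb.
pose e i := fine (\int[P]_w (expR (h i (X i w)))%:E).
have i0 i : (0 <= \int[P]_w (expR (h i (X i w)))%:E)%E.
  by apply: integral_ge0 => w _; rewrite lee_fin expR_ge0.
have eE i : (\int[P]_w (expR (h i (X i w)))%:E = (e i)%:E)%E.
  rewrite fineK // ge0_fin_numE //; exact: le_lt_trans (hb i) (ltry _).
have mexp i : measurable_fun setT (fun x => expR (h i x)).
  by apply: measurableT_comp => //; exact: measurable_expR.
have mXe i : measurable_fun setT (fun w => expR (h i (X i w))).
  exact: (measurableT_comp (mexp i) (measurable_funPT (X i))).
have mS := measurable_ge_sum D mh.
set S := [set w | _] in mS *.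
have H := independent_integral_prod Xind mexp (fun i x => expR_ge0 (h i x)) eE.
have SE : (P S = \int[P]_w (\1_S w)%:E)%E by rewrite integral_indic // setIT.
apply: (@le_trans _ _ (\int[P]_w ((expR (- D))%:E * (\prod_i expR (h i (X i w)))%:E))%E).
  rewrite SE; apply: ge0_le_integral => //.
  - by apply/measurable_EFinP; exact: measurable_indic.
  - apply/measurable_EFinP; apply: measurable_funM => //.
    by apply: measurable_prod => i _; exact: mXe.
  move=> w _; rewrite -EFinM lee_fin -expR_sum -expRD /indic.
  have [/set_mem wS|_] := boolP (w \in S); last exact: expR_ge0.
  by rewrite -[leLHS]expR0 ler_expR addrC subr_ge0.
rewrite ge0_integralZl_EFin ?expR_ge0 //; last 2 first.
- by move=> w _; rewrite lee_fin prodr_ge0 // => i _; exact: expR_ge0.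
- by apply/measurable_EFinP; apply: measurable_prod => i _; exact: mXe.
rewrite H -EFinM lee_fin addrC expRD ler_wpM2l ?expR_ge0 // expR_sum.
by apply: ler_prod => i _; rewrite -!lee_fin -eE i0 hb.
Qed.

End Chernoff.

(** * Measurability and tails *)

Section MeasurableNorm.
Context d (Omega : measurableType d) (R : realType).
Variables (n r : nat) (Y : {ffun 'I_r -> 'I_n} -> Omega -> R).
Hypotheses (n0 : (0 < n)%N) (mY : forall i, measurable_fun setT (Y i)).
Local Notation idx := {ffun 'I_r -> 'I_n}.

(* The norm is 1-Lipschitz for the l1 distance, so each strict sublevel set is a
   countable union of l1 balls centred at rational tensors. *)
Lemma measurable_injective_norm :
  measurable_fun setT (fun w => injective_norm (Y^~ w)).
Proof.
apply: (measurability _ (RGenInftyO.measurableE R)) => _ [_ [c ->] <-]; rewrite setTI.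
pose Q (q : {ffun idx -> rat}) : tensor R n r := fun i => ratr (q i).
have -> : (fun w => injective_norm (Y^~ w)) @^-1` `]-oo, c[%classic =
    \bigcup_q [set w | \sum_i `|Y i w - Q q i| < c - injective_norm (Q q)].
  apply/seteqP; split => w /=; rewrite in_itv /=.
    (* Half the gap, because the distance to [Q q] is spent twice: as the distance itself, and
       through the possible increase of [injective_norm (Q q)], which shrinks the radius. *)
    move=> Yc; pose e := (c - injective_norm (Y^~ w)) / 2.
    have e0 : 0 < e by rewrite divr_gt0 // subr_gt0.
    pose N : R := #|{: idx}|%:R + 1.
    have N0 : 0 < N by rewrite ltr_wpDl.
    have qP i : exists q, `|Y i w - ratr q| < e / N.
      have /rat_in_itvoo[q] : Y i w - e / N < Y i w + e / N.
        by have := divr_gt0 e0 N0; lra.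
      rewrite in_itv /= => /andP[h1 h2]; exists q; rewrite ltr_norml; lra.
    pose q : {ffun idx -> rat} := [ffun i => projT1 (cid (qP i))].
    have qe : \sum_i `|Y i w - Q q i| < e.
      apply: (@le_lt_trans _ _ (\sum_(i : idx) e / N)).
        apply: ler_sum => i _; rewrite /Q ffunE; case: cid => x /=; exact: ltW.
      rewrite sumr_const -mulr_natr mulrAC ltr_pdivrMr // ltr_pM2l //.
      by rewrite /N ltrDl.
    exists q => //=.
    have : injective_norm (Q q) <=
        injective_norm (Y^~ w) + \sum_i `|Y i w - Q q i|.
      apply: le_trans (injective_norm_lipschitz (Q q) (Y^~ w) n0) _.
      by rewrite lerD2l; apply: ler_sum => i _; rewrite distrC.
    move: qe; rewrite /e; lra.
  move=> [q _ /=] h.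
  have : injective_norm (Y^~ w) <=
      injective_norm (Q q) + \sum_i `|Y i w - Q q i|.
    exact: injective_norm_lipschitz.
  lra.
apply: countable_bigcupT_measurable => [|q]; first exact: countableP.
have -> : [set w | \sum_i `|Y i w - Q q i| < c - injective_norm (Q q)] =
    (fun w => \sum_i `|Y i w - Q q i|) @^-1` `]-oo, c - injective_norm (Q q)[%classic.
  by apply/seteqP; split => w /=; rewrite in_itv.
rewrite -[X in measurable X]setTI.
apply: measurable_sum => // i; apply: measurableT_comp => //.
exact: measurable_funB.
Qed.

End MeasurableNorm.

Section Tails.
Context d (Omega : measurableType d) (R : realType) (P : probability Omega R).

Lemma union_bound (J : finType) (B : set Omega) (A : J -> set Omega) (b : J -> R) :
  measurable B -> (forall j, measurable (A j)) ->
  (forall w, B w -> exists j, A j w) ->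
  (forall j, (P (A j) <= (b j)%:E)%E) ->
  (P B <= (\sum_j b j)%:E)%E.
Proof.
move=> mB mA BA Ab.
apply: (@le_trans _ _ (\sum_(j \in [set` enum J]) P (A j))%E).
  apply: content_sub_fsum => // w /BA[j Ajw]; exists j => //=.
  by rewrite mem_enum.
rewrite -fsbig_seq ?enum_uniq // big_enum /= -sumEFin.
by apply: lee_sum.
Qed.

(** A discrete layer-cake bound: the thresholds are [K] apart, and each one passed accounts for one
    more [K]. *)
Lemma le_sum_tails (K a x : R) (N : nat) : 0 < K -> x <= K * (a + N.+1%:R) ->
  x <= K * (a + 1) + K * \sum_(m < N) (K * (a + m.+1%:R) <= x)%R%:R.
Proof.
move=> K0; elim: N => [|N IH] xN.
  by rewrite big_ord0 mulr0 addr0.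
have [xN'|xN'] := lerP x (K * (a + N.+1%:R)).
  apply: le_trans (IH xN') _; rewrite lerD2l ler_pM2l // big_ord_recr /=.
  by rewrite lerDl.
rewrite (eq_bigr (fun=> 1)) => [|m _].
  rewrite sumr_const card_ord; apply: le_trans xN _.
  by rewrite -[N.+2%:R]natr1; lra.
suff -> : K * (a + m.+1%:R) <= x by [].
apply: le_trans (ltW xN'); rewrite ler_pM2l // lerD2l ler_nat ltnS.
by rewrite -ltnS.
Qed.

(** The bound [B] makes finitely many thresholds suffice. Their tails sum to at most 1, which adds
    one [K] to [K * (a + 1)]. *)
Lemma expectation_le_tails (X : Omega -> R) (K a B : R) :
  measurable_fun setT X -> (forall w, 0 <= X w) -> (forall w, X w <= B) ->
  0 < K -> 0 <= a ->
  (forall m : nat,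
    (P [set w | (K * (a + m.+1%:R) <= X w)%R] <= (2^-1 ^+ m.+1)%:E)%E) ->
  ('E_P[X] <= (K * (a + 2))%:E)%E.
Proof.
move=> mX X0 XB K0 a0 tail.
have [N XN] : exists N : nat, forall w, X w <= K * (a + N.+1%:R).
  exists (Num.truncn (Order.max 0 (B / K))) => w.
  apply: le_trans (XB w) _; rewrite mulrC -ler_pdivrMr //.
  have h0 : 0 <= Order.max 0 (B / K) by rewrite le_max lexx.
  have h1 : B / K <= Order.max 0 (B / K) by rewrite le_max lexx orbT.
  have /andP[_ /ltW h2] := truncn_itv h0.
  by rewrite (le_trans h1) // (le_trans h2) // lerDr.
pose S m := [set w | K * (a + m.+1%:R) <= X w].
have mS m : measurable (S m).
  have -> : S m = X @^-1` `[K * (a + m.+1%:R), +oo[%classic.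
    by apply/seteqP; split => w /=; rewrite in_itv /= andbT.
  by rewrite -[X in measurable X]setTI; exact: mX.
have SE m w : (K * (a + m.+1%:R) <= X w)%R%:R = \1_(S m) w :> R.
  rewrite /indic; congr (_%:R); congr nat_of_bool; apply/idP/idP => [h|/set_mem //].
  exact/mem_set.
rewrite unlock.
apply: (@le_trans _ _ (\int[P]_w ((K * (a + 1))%:E + \sum_(m < N) (K%:E * (\1_(S m) w)%:E)))%E).
  apply: ge0_le_integral => //.
  - by move=> w _; rewrite lee_fin.
  - exact/measurable_EFinP.
  - apply: emeasurable_funD => //; apply: emeasurable_sum => m.
    by apply/measurable_EFinP; apply: measurable_funM => //; exact: measurable_indic.
  - move=> w _; under eq_bigr do rewrite -EFinM.
    rewrite sumEFin -EFinD lee_fin.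
    rewrite -mulr_sumr; under eq_bigr do rewrite -SE.
    exact: le_sum_tails.
have mI m : measurable_fun setT (fun w => (K%:E * (\1_(S m) w)%:E)%E).
  by apply/measurable_EFinP; apply: measurable_funM => //; exact: measurable_indic.
have I0 m w : (0 <= K%:E * (\1_(S m) w)%:E)%E.
  by rewrite -EFinM lee_fin mulr_ge0 ?(ltW K0).
have Ka : 0 <= K * (a + 1) by rewrite mulr_ge0 ?(ltW K0) ?addr_ge0.
rewrite ge0_integralD //; last 2 first.
- by move=> w _; apply: sume_ge0.
- by apply: emeasurable_sum => m.
rewrite integral_cst // [X in (_ * X + _)%E]probability_setT mule1.
rewrite ge0_integral_sum //.
have -> : (K * (a + 2))%:E = ((K * (a + 1))%:E + K%:E)%E.
  by rewrite -EFinD; congr EFin; ring.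
rewrite leeD2l //.
apply: (@le_trans _ _ (\sum_(m < N) (K * 2^-1 ^+ m.+1)%:E)%E).
  apply: lee_sum => m _; rewrite ge0_integralZl_EFin ?(ltW K0) //; last first.
    by apply/measurable_EFinP; exact: measurable_indic.
  rewrite integral_indic // setIT EFinM; apply: lee_wpmul2l; last exact: tail.
  by rewrite lee_fin ltW.
rewrite sumEFin lee_fin -mulr_sumr -[leRHS]mulr1 ler_pM2l //.
suff -> : \sum_(m < N) (2^-1 : R) ^+ m.+1 = 1 - 2^-1 ^+ N.
  by rewrite lerBlDr lerDl exprn_ge0 // invr_ge0.
elim: (N) => [|M IH]; first by rewrite big_ord0 expr0 subrr.
by rewrite big_ord_recr /= IH exprS; field.
Qed.

End Tails.

(** * Entropy of the grid *)

Section Counting.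
Variable R : realType.

(** [1 - 1/8 <= e^(-1/8)] gives [e^(1/8) <= 8/7], and [(8/7)^10 <= 5]. *)
Lemma ln5_ge : 5 / 4 <= ln 5 :> R.
Proof.
have e8 : expR (8^-1) <= 8 / 7 :> R.
  have h : 7 / 8 <= expR (- 8^-1) :> R by have := @expR_ge1Dx R (- 8^-1); lra.
  rewrite -[leLHS]invrK -expRN -[leRHS]invrK lef_pV2 ?posrE ?expR_gt0 ?invr_gt0 //; lra.
rewrite -[leLHS](@expRK R) ler_ln ?posrE ?expR_gt0 //.
have -> : 5 / 4 = 10%:R * 8^-1 :> R by field.
rewrite expRM_natl.
apply: (@le_trans _ _ ((8 / 7) ^+ 10)); first by rewrite lerXn2r ?nnegrE ?expR_ge0.
by rewrite !exprS expr0; lra.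
Qed.

Lemma order_bounds (n r : nat) (eps : R) : (5 <= n)%N -> 0 < eps -> eps < 1 ->
  r%:R <= eps * ln n%:R / (5 * ln (ln n%:R)) -> 1 <= ln n%:R :> R /\ (r <= n)%N.
Proof.
move=> n5 e0 e1 hr.
have n0R : 0 < n%:R :> R by rewrite ltr0n (leq_trans _ n5).
have l5 : 5 / 4 <= ln n%:R :> R.
  by apply: le_trans ln5_ge _; rewrite ler_ln ?posrE // ler_nat.
have l0 : 0 < ln n%:R :> R by lra.
split; first lra.
(* From [ln x <= x - 1] at [x = 1 / ln n <= 4/5]; it makes the denominator [5 * ln (ln n)] at least
   1. *)
have ll : 1 / 5 <= ln (ln n%:R) :> R.
  have iv : (ln n%:R)^-1 <= 4 / 5 :> R.
    have -> : 4 / 5 = (5 / 4)^-1 :> R by field.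
    by rewrite lef_pV2 ?posrE //; lra.
  have iv0 : 0 < (ln n%:R)^-1 :> R by rewrite invr_gt0.
  have h := @le_ln1Dx R ((ln n%:R)^-1 - 1).
  rewrite [1 + _]addrC subrK lnV ?posrE // in h.
  have : - ln (ln n%:R) <= (ln n%:R)^-1 - 1 :> R by apply: h; lra.
  lra.
rewrite -(ler_nat R); apply: le_trans hr _.
apply: (@le_trans _ _ (ln n%:R)); last exact/ltW/ln_sublinear.
by rewrite ler_pdivrMr; [nra|lra].
Qed.

Lemma x_le_expR_half (x : R) : x <= 2 * expR (x / 2).
Proof. have := expR_ge1Dx (x / 2); lra. Qed.

Lemma natr_expR_ln (n : nat) : (0 < n)%N -> n%:R = expR (ln n%:R) :> R.
Proof. by move=> n0; rewrite lnK // posrE ltr0n. Qed.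

Variables (n r : nat).

Lemma grid_point_eq0 (N : nat) (z : 'I_N.*2.+1) : (0 < N)%N ->
  (grid_point R z != 0) = (z != N :> nat).
Proof.
move=> N0; rewrite /grid_point mulf_eq0 invr_eq0 subr_eq0 eqr_nat pnatr_eq0.
by rewrite -[(N == 0)%N]negbK -lt0n N0 orbF.
Qed.

(** The generating function of the number of nonzero entries factorises over the [n * r]
    coordinates, each with one zero value and [2 N] nonzero ones. *)
Lemma sum_expR_nnz (N : nat) (q : R) : (0 < N)%N ->
  \sum_(s : {ffun 'I_r -> {ffun 'I_n -> 'I_N.*2.+1}})
    expR (q * (nnz (fun k j => grid_point R (s k j)))%:R) =
  (1 + N.*2%:R * expR q) ^+ (n * r).
Proof.
move=> N0.
pose f (z : 'I_N.*2.+1) : R := expR (q * (z != N :> nat)%:R).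
have fE : \sum_z f z = 1 + N.*2%:R * expR q.
  have mid : (N < N.*2.+1)%N by rewrite ltnS -addnn leq_addr.
  rewrite (bigD1 (Ordinal mid)) //= /f eqxx mulr0 expR0; congr (_ + _).
  rewrite (eq_bigr (fun=> expR q)) => [|z zN]; last first.
    suff -> : (z != N :> nat) by rewrite mulr1.
    by apply: contra zN => /eqP zN; apply/eqP/val_inj.
  by rewrite sumr_const cardC1 card_ord mulr_natl.
under eq_bigr => s _.
  rewrite /nnz natr_sum mulr_sumr expR_sum.
  under eq_bigr => k _.
    rewrite natr_sum mulr_sumr expR_sum.
    under eq_bigr => j _ do rewrite grid_point_eq0 // -/(f _).
    over.
  over.
rewrite -(bigA_distr_bigA (fun (k : 'I_r) (v : {ffun 'I_n -> 'I_N.*2.+1}) => \prod_j f (v j))) /=.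
rewrite (eq_bigr (fun=> (1 + N.*2%:R * expR q) ^+ n)).
  by rewrite prodr_const card_ord exprM.
move=> k _; rewrite -(bigA_distr_bigA (fun (j : 'I_n) z => f z)) /= fE.
by rewrite prodr_const card_ord.
Qed.

Hypotheses (n4 : (4 <= n)%N) (r0 : (0 < r)%N) (rn : (r <= n)%N).

Let n0 : (0 < n)%N. Proof. exact: leq_trans n4. Qed.

Lemma net_size_gt0 : (0 < net_size n r)%N.
Proof. by rewrite /net_size !muln_gt0 expn_gt0 n0 r0. Qed.

(** A nonzero entry has [2 * net_size = 4 * r * n^r <= n^(r+2)] possible values. The penalty
    [n^-(r+3)] therefore leaves [1 / n] per coordinate, and [(1 + 1/n)^(n r) <= e^r]. This is the
    entropy estimate of the union bound, with all supports treated at once. *)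
Lemma sum_expR_net (l : R) : n%:R = expR l ->
  \sum_s expR (- l * ((r + 3)%:R * (nnz (@grid_vectors R n r s))%:R))
    <= expR r%:R.
Proof.
move=> nE; have n0R : 0 < n%:R :> R by rewrite ltr0n.
under eq_bigr do rewrite mulrA.
rewrite sum_expR_nnz ?net_size_gt0 //.
apply: (@le_trans _ _ ((1 + n%:R^-1) ^+ (n * r))).
  rewrite lerXn2r ?nnegrE ?addr_ge0 ?mulr_ge0 ?expR_ge0 ?invr_ge0 //.
  rewrite lerD2l mulNr expRN mulrC expRM_natr -nE -mulrC -ler_pdivlMr ?invr_gt0 ?exprn_gt0 //.
  rewrite invrK mulrC -natrX.
  have -> : (r + 3 = (r + 2).+1)%N by rewrite addnS.
  rewrite expnSr natrM mulfK ?gt_eqF // ler_nat /net_size -muln2 addn2 !expnS.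
  have -> : (2 * r * n ^ r * 2 = 4 * r * n ^ r)%N by lia.
  by rewrite mulnA leq_mul2r leq_mul // orbT.
apply: (@le_trans _ _ (expR (n%:R^-1) ^+ (n * r))).
  rewrite lerXn2r ?nnegrE ?expR_ge0 ?addr_ge0 ?invr_ge0 //.
  exact: expR_ge1Dx.
by rewrite -expRM_natr natrM mulrA mulVf ?mul1r // gt_eqF.
Qed.

End Counting.

(** * Sparse random tensors *)

Section SparseTensor.
Context d (Omega : measurableType d) (R : realType) (P : probability Omega R).
Variables (n r : nat) (T : {ffun 'I_r -> 'I_n} -> {RV P >-> R}).
Variables (eps L l p : R).
Local Notation idx := {ffun 'I_r -> 'I_n}.
Local Notation config := {ffun 'I_r -> {ffun 'I_n -> 'I_(net_size n r).*2.+1}}.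

Hypotheses (n5 : (5 <= n)%N) (r2 : (2 <= r)%N) (rn : (r <= n)%N).
Hypotheses (l1 : 1 <= l) (eps0 : 0 < eps) (eps1 : eps < 1) (L1 : 1 <= L).
Hypothesis Tind : mutually_independent T.
Hypothesis T1 : forall i w, -1 <= T i w <= 1.

Hypotheses (nE : n%:R = expR l) (pE : p = L * expR ((-1 - eps) * l)).
Hypothesis Tp : forall i, (P [set w | (T i w <> 0)%R] <= p%:E)%E.

Let n0 : (0 < n)%N. Proof. exact: leq_trans n5. Qed.
Let n0R : 0 < n%:R :> R. Proof. by rewrite ltr0n. Qed.
Let p0 : 0 <= p. Proof. by rewrite pE mulr_ge0 ?expR_ge0 // (le_trans _ L1). Qed.

Lemma measurable_neq0 : measurable_fun setT (fun x : R => (x != 0)%:R : R).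
Proof.
have -> : (fun x : R => (x != 0)%:R) = \1_(~` [set 0 : R]) :> (R -> R).
  apply/funext => x; rewrite /indic; congr (_%:R); congr nat_of_bool.
  by apply/idP/idP => [/eqP h0|/set_mem /= /eqP //]; exact/mem_set.
by apply: measurable_indic; exact: measurableC.
Qed.

(** The condition [i' == fiber i k (i' k)] selects the line through [i] in direction [k]. The
    exponential parameter [eps * l] multiplies [n * p] by [n^eps], and the product is exactly
    [L]. *)
Lemma fiber_degree_tail (k : 'I_r) (i : idx) (D : R) :
  (P [set w | (eps * l * D <= \sum_(i' : idx) (if i' == fiber i k (i' k) then
        eps * l * (T i' w != 0)%:R else 0))%R] <= (expR (L - eps * l * D))%:E)%E.
Proof.
pose h (i' : idx) (x : R) : R := if i' == fiber i k (i' k) then eps * l * (x != 0)%:R else 0.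
pose b (i' : idx) := if i' == fiber i k (i' k) then p * expR (eps * l) else 0.
have lam0 : 0 <= eps * l by rewrite mulr_ge0 ?ltW // (lt_le_trans _ l1).
have mh i' : measurable_fun setT (h i').
  rewrite /h; case: eqP => _; last exact: measurable_cst.
  by apply: measurable_funM => //; exact: measurable_neq0.
have hb i' : (\int[P]_w (expR (h i' (T i' w)))%:E <= (expR (b i'))%:E)%E.
  rewrite /h /b; case: eqP => _; first exact: mgf_nonzero.
  by rewrite integral_cst // [X in (_ * X)%E]probability_setT mule1.
apply: le_trans (chernoff_sum Tind (eps * l * D) mh hb) _.
rewrite lee_fin ler_expR lerD2r /b -big_mkcond /=.
rewrite (reindex_onto (fiber i k) (fun i' : idx => i' k)) /=; last by move=> i' /eqP <-.
rewrite (eq_bigl xpredT); last by move=> j; rewrite !ffunE !eqxx.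
rewrite sumr_const card_ord -mulr_natl nE pE.
have -> : expR l * (L * expR ((-1 - eps) * l) * expR (eps * l)) =
    L * expR (l + (-1 - eps) * l + eps * l) by rewrite !expRD; ring.
have -> : l + (-1 - eps) * l + eps * l = 0 by ring.
by rewrite expR0 mulr1.
Qed.

Definition zone_dev (a : nat) (H : R) : R :=
  4 * 4^-1 ^+ a * H / eps + 2 * L / n%:R * 4 ^+ a.

(** In [zone_dev] the first term buys the probability [n^-H], while the second pays for the moment
    bound of [mgf_centered]. *)
Lemma zone_tail (a : nat) (c : idx -> R) (H : R) :
  (forall i, `|c i| <= 4^-1 ^+ a) -> \sum_i c i ^+ 2 <= 1 ->
  (P [set w | (zone_dev a H <= \sum_i c i * (T i w - fine 'E_P[T i]))%R]
     <= (expR (- l * H))%:E)%E.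
Proof.
move=> cM c1; set M := 4^-1 ^+ a in cM; set m := fun i => fine 'E_P[T i].
have M0 : 0 < M by rewrite exprn_gt0 // invr_gt0.
have l0 : 0 < l by exact: lt_le_trans l1.
(* This choice makes [expR (2 * lam * M)] equal to [n^(eps/2)], half of the gain [n^-eps] from
   sparsity. The other half absorbs a factor [eps * l] by [x_le_expR_half], so no logarithm
   survives. *)
pose lam := eps * l / (4 * M).
have lam0 : 0 < lam by rewrite divr_gt0 ?mulr_gt0.
pose h i x := lam * (c i * (x - m i)).
pose b i := 4 * p * (lam * c i) ^+ 2 * expR (2 * lam * M).
have mh i : measurable_fun setT (h i).
  by apply: measurable_funM => //; apply: measurable_funM => //; exact: measurable_funB.
have hb i : (\int[P]_w (expR (h i (T i w)))%:E <= (expR (b i))%:E)%E.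
  exact: (mgf_centered (T1 i) (ltW lam0) (cM i) (Tp i)).
have := chernoff_sum Tind (lam * zone_dev a H) mh hb.
have -> : [set w | lam * zone_dev a H <= \sum_i h i (T i w)] =
    [set w | zone_dev a H <= \sum_i c i * (T i w - m i)].
  by apply/seteqP; split => w /=; rewrite /h -mulr_sumr ler_pM2l.
move=> /le_trans; apply; rewrite lee_fin ler_expR.
have bs : \sum_i b i <= 4 * p * lam ^+ 2 * expR (2 * lam * M).
  have -> : \sum_i b i = 4 * p * lam ^+ 2 * expR (2 * lam * M) * \sum_i c i ^+ 2.
    by rewrite mulr_sumr; apply: eq_bigr => i _; rewrite /b; ring.
  have k0 : 0 <= 4 * p * lam ^+ 2 by rewrite mulr_ge0 ?sqr_ge0 // mulr_ge0.
  by rewrite ler_piMr // mulr_ge0 ?expR_ge0.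
have lM : 2 * lam * M = eps * l / 2 by rewrite /lam; field; rewrite gt_eqF.
have bE : 4 * p * lam ^+ 2 * expR (2 * lam * M) =
    L / n%:R * (eps * l / (4 * M ^+ 2)) * (eps * l / expR (eps * l / 2)).
  rewrite lM pE /lam.
  have -> : (-1 - eps) * l = - l - (eps * l / 2 + eps * l / 2) by field.
  rewrite expRD !expRN expRD -nE; field.
  by rewrite !gt_eqF ?expR_gt0.
have x2 : eps * l / expR (eps * l / 2) <= 2.
  by rewrite ler_pdivrMr ?expR_gt0 // x_le_expR_half.
have dE : lam * zone_dev a H = l * H + L / n%:R * (eps * l / (4 * M ^+ 2)) * 2.
  rewrite /zone_dev -/M -[4 ^+ a]invrK -exprVn -/M /lam; field.
  by rewrite !gt_eqF.
have : L / n%:R * (eps * l / (4 * M ^+ 2)) * (eps * l / expR (eps * l / 2)) <=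
    L / n%:R * (eps * l / (4 * M ^+ 2)) * 2.
  apply: ler_wpM2l => //; rewrite mulr_ge0 ?divr_ge0 ?mulr_ge0 ?exprn_ge0 //.
  all: rewrite ?(ltW M0) ?(ltW eps0) ?(ltW l0) //.
  exact: le_trans L1.
rewrite dE; move: bs; rewrite bE; lra.
Qed.

(** The last scale is the one where [4^-A] is of order [1 / n]. *)
Local Notation A := (trunc_log 4 n).

Let An : (4 ^ A <= n < 4 ^ A.+1)%N. Proof. exact: trunc_log_bounds. Qed.

Local Notation be := ((r + 3)%:R : R).

(** * Exceptional events and their union bound *)

Definition in_ball (s : config) : bool :=
  [forall k, \sum_j @grid_vectors R n r s k j ^+ 2 <= 1].

(** The summand [L] offsets the factor [e^L] of [fiber_degree_tail]; [r + 1] pays for the at most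
    [n^(r+1)] pairs [(k, i)], and [n^-(t+1)] remains. *)
Definition degree_bound (t : R) : R := (L + r%:R + t + 2) / eps.

(** The first term pays for the choice of grid vectors as in [sum_expR_net], [r] for the [e^r] left
    there, and 2 of the 3 for the scales and signs. *)
Definition zone_entropy (t : R) (s : config) : R :=
  be * (nnz (@grid_vectors R n r s))%:R + (r%:R + t + 3).

(** Either a line has too many nonzero entries, or a zone sum is too large; the boolean is its sign,
    as [zone_tail] is one-sided. Outside the ball the event is empty, so the union may range over
    all configurations. *)
Definition exceptional (t : R) (j : ('I_r * idx) + ('I_A.+1 * config * bool)) :
    set Omega :=
  match j with
  | inl (k, i) => [set w | eps * l * degree_bound t <=
      \sum_(i' : idx) (if i' == fiber i k (i' k) then eps * l * (T i' w != 0)%:R else 0)]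
  | inr (a, s, b) => [set w | in_ball s /\
      zone_dev a (zone_entropy t s) <=
      \sum_i ((-1) ^+ b * zone_weight A a (@grid_vectors R n r s) i) *
        (T i w - fine 'E_P[T i])]
  end.

Definition exceptional_bound (t : R)
    (j : ('I_r * idx) + ('I_A.+1 * config * bool)) : R :=
  match j with
  | inl _ => expR (- l * (r%:R + t + 2))
  | inr (_, s, _) => expR (- l * zone_entropy t s)
  end.

Lemma exceptional_measurable t j : measurable (exceptional t j).
Proof.
case: j => [[k i]|[[a s] b]] /=.
  apply: (@measurable_ge_sum _ _ _ _ _ T (fun (i' : idx) x =>
      if i' == fiber i k (i' k) then eps * l * (x != 0)%:R else 0)) => i'.
  case: eqP => _; last exact: measurable_cst.
  by apply: measurable_funM => //; exact: measurable_neq0.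
case: (in_ball s); last first.
  rewrite (_ : [set w | _] = set0) //; apply/seteqP; split => w //=.
  by case.
pose h (i : idx) x : R :=
  ((-1) ^+ b * zone_weight A a (@grid_vectors R n r s) i) * (x - fine 'E_P[T i]).
rewrite (_ : [set w | _] =
    [set w | zone_dev a (zone_entropy t s) <= \sum_i h i (T i w)]); last first.
  by apply/seteqP; split => w /=; [case|].
apply: (@measurable_ge_sum _ _ _ _ _ T h) => i.
by apply: measurable_funM => //; exact: measurable_funB.
Qed.

Lemma exceptional_prob t j : 0 < t ->
  (P (exceptional t j) <= (exceptional_bound t j)%:E)%E.
Proof.
move=> t0; case: j => [[k i]|[[a s] b]] /=.
  apply: le_trans (fiber_degree_tail k i _) _; rewrite lee_fin ler_expR.
  have -> : eps * l * degree_bound t = l * (L + r%:R + t + 2).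
    by rewrite /degree_bound; field; rewrite gt_eqF.
  have : L * 1 <= L * l by rewrite ler_wpM2l // (le_trans _ L1).
  lra.
case: (boolP (in_ball s)) => [/forallP ball|_]; last first.
  rewrite (_ : [set w | _] = set0) ?measure0 ?lee_fin ?expR_ge0 //.
  by apply/seteqP; split => w //=; case.
rewrite (_ : [set w | _] = [set w | zone_dev a (zone_entropy t s) <=
    \sum_i ((-1) ^+ b * zone_weight A a (@grid_vectors R n r s) i) *
      (T i w - fine 'E_P[T i])]); last first.
  by apply/seteqP; split => w /=; [case|].
apply: zone_tail => [i|].
  by rewrite normrM normrX normrN1 expr1n mul1r zone_weight_le // ltnW.
under eq_bigr do rewrite exprMn sqrr_sign mul1r.
exact: zone_weight_sqr.
Qed.

Lemma sum_exceptional_bound t : 0 < t ->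
  \sum_j exceptional_bound t j <= expR (- l * t).
Proof.
move=> t0; have l0 : 0 < l by exact: lt_le_trans l1.
rewrite big_sumType /=.
have E1 : \sum_(j : 'I_r * idx) expR (- l * (r%:R + t + 2)) <= expR (- l * (t + 1)).
  rewrite sumr_const card_prod card_ffun !card_ord -[leLHS]mulr_natl.
  apply: (@le_trans _ _ ((n ^ r.+1)%:R * expR (- l * (r%:R + t + 2)))).
    by rewrite ler_wpM2r ?expR_ge0 // ler_nat expnS leq_mul2r rn orbT.
  rewrite natrX nE -expRM_natl -expRD ler_expR -natr1; lra.
have E2 : \sum_(j : 'I_A.+1 * config * bool) exceptional_bound t (inr j) <=
    expR (- l * (t + 1)).
  pose G (x : 'I_A.+1 * config) (b : bool) := expR (- l * zone_entropy t x.2).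
  pose G' (a : 'I_A.+1) (s : config) := expR (- l * zone_entropy t s).
  rewrite (eq_bigr (fun j => G j.1 j.2)); last by move=> [[]].
  rewrite -(pair_bigA _ G) exchange_big /G /= sumr_const card_bool.
  rewrite (eq_bigr (fun j => G' j.1 j.2)); last by move=> [].
  rewrite -(pair_bigA _ G') /G' /=.
  rewrite sumr_const card_ord -mulrnA -[leLHS]mulr_natl.
  under eq_bigr do rewrite /zone_entropy mulrDr expRD.
  rewrite -mulr_suml.
  (* There are [A + 1 <= n] scales, since [A < 4 ^ A <= n], and two signs. *)
  apply: (@le_trans _ _ ((n ^ 2)%:R * (expR r%:R * expR (- l * (r%:R + t + 3))))).
    apply: ler_pM => //; first by rewrite mulr_ge0 ?expR_ge0 // sumr_ge0 // => s _; exact: expR_ge0.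
      rewrite ler_nat; have An' : (A < n)%N.
        have [An1 _] := andP An; apply: leq_trans An1; exact: ltn_expl.
      nia.
    rewrite ler_wpM2r ?expR_ge0 //; apply: sum_expR_net => //.
      exact: ltnW.
    exact: ltnW.
  rewrite natrX nE -expRM_natl -!expRD ler_expR.
  have : r%:R * 1 <= r%:R * l by rewrite ler_wpM2l.
  lra.
apply: le_trans (lerD E1 E2) _.
have -> : - l * t = l + - l * (t + 1) by ring.
rewrite [leRHS]expRD -nE -[leLHS]mulr2n -[leLHS]mulr_natl ler_wpM2r ?expR_ge0 //.
by rewrite ler_nat (leq_trans _ n5).
Qed.

Lemma norm_mean_le_p i : `|fine 'E_P[T i]| <= p.
Proof.
apply: le_trans (norm_expectation_le (T1 i)) _.
by rewrite -lee_fin fineK // fin_num_measure //; exact: measurable_nonzero.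
Qed.

Lemma norm_mean_le1 i : `|fine 'E_P[T i]| <= 1.
Proof.
have mS : measurable [set w | T i w <> 0] by exact: measurable_nonzero.
apply: le_trans (norm_expectation_le (T1 i)) _.
by rewrite -lee_fin fineK ?fin_num_measure // probability_le1.
Qed.

Lemma norm_centered_le2 w i : `|centered T w i| <= 2.
Proof.
apply: le_trans (ler_normB _ _) _; have := norm_mean_le1 i.
have : `|T i w| <= 1 by rewrite ler_norml T1.
lra.
Qed.

(** Zero is a grid point, so truncated grid vectors are again grid vectors and are covered by the
    exceptional events. *)
Lemma truncate_config (s : config) (a : nat) :
  exists s' : config, @grid_vectors R n r s' = truncate A a (@grid_vectors R n r s).
Proof.
have mid : (net_size n r < (net_size n r).*2.+1)%N by rewrite ltnS -addnn leq_addr.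
exists [ffun k => [ffun j => if (level A `|@grid_vectors R n r s k j| <= a)%N
                             then s k j else Ordinal mid]].
apply/funext => k; apply/funext => j; rewrite /truncate {1}/grid_vectors !ffunE.
case: ifP => // _; apply/eqP; rewrite -[_ == _]negbK grid_point_eq0 /= ?eqxx //.
by apply: net_size_gt0 => //; exact: ltnW.
Qed.

Lemma injective_norm_typical t w : 0 < t ->
  (forall j, ~ exceptional t j w) ->
  injective_norm (centered T w) <=
    r%:R * (degree_bound t + L) +
    4 / eps * (11 * be * r%:R + 4 / 3 * (r%:R + t + 3)) +
    4 / 3 * (2 * L / n%:R) * n%:R + 1.
Proof.
move=> t0 typ.
have l0 : 0 < l by exact: lt_le_trans l1.
have L0 : 0 <= L by exact: le_trans L1.
apply: injective_norm_grid => // [|i|s ball]; [exact: ltnW|exact: norm_centered_le2|].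
(* The dominating tensor: the indicator bounds the entry and [p] its mean. On a line the first sums
   to at most [degree_bound t], the second to [n * p <= L]. *)
apply: (@tensor_sum_le _ _ _ A _ (fun i => (T i w != 0)%:R + p)) => //.
- by rewrite divr_ge0 // ltW.
- by rewrite !addr_ge0 // ltW.
- by rewrite divr_ge0 // mulr_ge0.
- move=> i; apply: le_trans (ler_normB _ _) _; apply: lerD; last exact: norm_mean_le_p.
  have [->|_] /= := eqVneq (T i w) 0; first by rewrite normr0.
  by rewrite ler_norml T1.
- move=> k i; rewrite big_split /=; apply: lerD.
    have := typ (inl (k, i)) => /=; rewrite -big_mkcond /=.
    rewrite (reindex_onto (fiber i k) (fun i' : idx => i' k)) /=; last by move=> i' /eqP <-.
    rewrite (eq_bigl xpredT); last by move=> j; rewrite !ffunE !eqxx.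
    by rewrite -mulr_sumr ler_pM2l ?mulr_gt0 // => /negP; rewrite -ltNge => /ltW.
  rewrite sumr_const card_ord -[leLHS]mulr_natl nE pE mulrCA -expRD.
  rewrite -[leRHS]mulr1 ler_wpM2l // expR_le1.
  have -> : l + (-1 - eps) * l = - (eps * l) by ring.
  by rewrite oppr_le0 mulr_ge0 ?ltW.
move=> a; have [s' s'E] := truncate_config s a.
have ball' : in_ball s'.
  apply/forallP => k; rewrite s'E; exact: le_trans (truncate_sqr _ _ _ _) (ball k).
have dE : 4 / eps * 4^-1 ^+ a *
      (be * (nnz (truncate A a (@grid_vectors R n r s)))%:R + (r%:R + t + 3)) +
      2 * L / n%:R * 4 ^+ a = zone_dev a (zone_entropy t s').
  rewrite /zone_dev /zone_entropy s'E; congr (_ + _); rewrite -!mulrA; congr (4 * _).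
  by rewrite mulrCA; congr (_ * _); rewrite mulrC.
rewrite dE -s'E ler_norml.
have Z b : \sum_i ((-1) ^+ b * zone_weight A a (@grid_vectors R n r s') i) *
    (T i w - fine 'E_P[T i]) =
    (-1) ^+ b * \sum_i centered T w i * zone_weight A a (@grid_vectors R n r s') i.
  by rewrite mulr_sumr; apply: eq_bigr => i _; rewrite -mulrA [centered _ _ _ * _]mulrC.
(* The two signs together bound the absolute value of the zone sum. *)
have := typ (inr (a, s', true)); have := typ (inr (a, s', false)) => /=.
rewrite !Z expr0 expr1 mul1r mulN1r => h1 h2.
apply/andP; split.
  by rewrite lerNl leNgt; apply/negP => h; apply: h2; split => //; exact: ltW.
by rewrite leNgt; apply/negP => h; apply: h1; split => //; exact: ltW.
Qed.

(** After multiplication by [eps], every term is compared with [L * r * S], where [S = r + t], and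
    [r ^+ 2 >= 4] gives room to spare. Strictness lets it contradict the non-strict tail event. *)
Lemma typical_bound_lt t (K : R) : 0 < t -> 200 * (L * r%:R ^+ 3 / eps) <= K ->
  r%:R * (degree_bound t + L) +
    4 / eps * (11 * be * r%:R + 4 / 3 * (r%:R + t + 3)) +
    4 / 3 * (2 * L / n%:R) * n%:R + 1 < K * (r%:R + t).
Proof.
move=> t0 KL.
have rR : 2 <= r%:R :> R by rewrite ler_nat.
set rr := r%:R in rR KL *; pose S := rr + t.
have S2 : 2 <= S by rewrite /S; lra.
apply: (@lt_le_trans _ _ (200 * (L * rr ^+ 3 / eps) * S)); last by rewrite ler_wpM2r //; lra.
rewrite natrD -/rr /degree_bound -/rr.
rewrite -(ltr_pM2r eps0).
have -> : (rr * ((L + rr + t + 2) / eps + L) +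
    4 / eps * (11 * (rr + 3) * rr + 4 / 3 * (rr + t + 3)) +
    4 / 3 * (2 * L / n%:R) * n%:R + 1) * eps =
    rr * (L + S + 2) + 44 * (rr + 3) * rr + 16 / 3 * (S + 3) +
    (rr * L + 8 / 3 * L + 1) * eps.
  by rewrite /S; field; rewrite !gt_eqF.
have -> : 200 * (L * rr ^+ 3 / eps) * S * eps = 200 * (rr ^+ 2 * (L * (rr * S))).
  by field; rewrite gt_eqF.
have L0 : 0 <= L by exact: le_trans L1.
have rrS : 4 <= rr * S by nra.
have rS : rr <= S by rewrite /S; lra.
have LrS : rr * S <= L * (rr * S) by rewrite ler_peMl //; lra.
have LL : L * 4 <= L * (rr * S) by rewrite ler_wpM2l.
have rL : rr * L * 2 <= L * (rr * S).
  have -> : L * (rr * S) = rr * L * S by ring.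
  by rewrite ler_wpM2l // mulr_ge0 //; lra.
have rS2 : rr * 2 <= rr * S by rewrite ler_wpM2l //; lra.
have S2' : 2 * S <= rr * S by rewrite ler_wpM2r //; lra.
have r2S : rr * rr <= rr * S by rewrite ler_wpM2l //; lra.
have e1 : (rr * L + 8 / 3 * L + 1) * eps <= rr * L + 8 / 3 * L + 1.
  have rL0 : 0 <= rr * L by rewrite mulr_ge0 //; lra.
  by rewrite ler_piMr ?(ltW eps1) //; lra.
have big : 4 * (L * (rr * S)) <= rr ^+ 2 * (L * (rr * S)).
  by rewrite ler_wpM2r //; [lra|rewrite expr2; nra].
lra.
Qed.

Lemma injective_norm_tail t (K : R) : 0 < t -> 200 * (L * r%:R ^+ 3 / eps) <= K ->
  (P [set w | (K * (r%:R + t) <= injective_norm (centered T w))%R]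
    <= (expR (- l * t))%:E)%E.
Proof.
move=> t0 KL.
apply: (@le_trans _ _ (\sum_j exceptional_bound t j)%:E); last first.
  by rewrite lee_fin; exact: sum_exceptional_bound.
apply: (union_bound (A := exceptional t)).
- have mX : measurable_fun setT (fun w => injective_norm (centered T w)).
    apply: (measurable_injective_norm n0 (Y := fun i w => T i w - fine 'E_P[T i])) => i.
    by apply: measurable_funB => //; exact: measurable_funPT.
  rewrite (_ : [set w | _] = (fun w => injective_norm (centered T w)) @^-1`
      `[K * (r%:R + t), +oo[%classic).
    by rewrite -[X in measurable X]setTI; exact: mX.
  by apply/seteqP; split => w /=; rewrite in_itv /= andbT.
- by move=> j; exact: exceptional_measurable.
- move=> w /= Kw; apply/not_existsP => typ.
  have := injective_norm_typical t0 typ; rewrite leNgt => /negP; apply.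
  exact: lt_le_trans (typical_bound_lt t0 KL) Kw.
- by move=> j; exact: exceptional_prob.
Qed.

Lemma injective_norm_expectation :
  ('E_P[fun w => injective_norm (centered T w)] <=
    (200 * (L * r%:R ^+ 3 / eps) * (r%:R + 2))%:E)%E.
Proof.
have l0 : 0 < l by exact: lt_le_trans l1.
apply: (@expectation_le_tails _ _ _ _ _ _ _ (\sum_(i : idx) 2)) => //.
- apply: (measurable_injective_norm n0 (Y := fun i w => T i w - fine 'E_P[T i])) => i.
  by apply: measurable_funB => //; exact: measurable_funPT.
- by move=> w; exact: injective_norm_ge0.
- move=> w; apply: injective_norm_le => // x x1.
  apply: le_trans (tensor_dot_le _ x1) _; apply: ler_sum => i _.
  exact: norm_centered_le2.
- rewrite mulr_gt0 // divr_gt0 // mulr_gt0 ?exprn_gt0 ?(lt_le_trans _ L1) //.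
  by rewrite ltr0n ltnW.
(* The tail is used at [t = m + 1], where [n^-(m+1) <= 2^-(m+1)]. *)
move=> m; apply: le_trans (injective_norm_tail _ (lexx _)) _ => //.
rewrite lee_fin expRM_natr expRN -nE lerXn2r ?nnegrE ?invr_ge0 ?(ltW n0R) //.
by rewrite lef_pV2 ?posrE // ler_nat (leq_trans _ n5).
Qed.

End SparseTensor.

Theorem theorem3p1 (R : realType) :
  exists C : R, 0 < C /\
  forall (n r : nat) (eps : R),
    (5 <= n)%N -> (2 <= r)%N -> 0 < eps -> eps < 1 ->
    r%:R <= eps * ln n%:R / (5 * ln (ln n%:R)) ->
  forall (d : measure_display) (Omega : measurableType d)
    (P : probability Omega R)
    (T : {ffun 'I_r -> 'I_n} -> {RV P >-> R}) (L : R),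
    mutually_independent T ->
    (forall i w, -1 <= T i w <= 1) ->
    1 <= L ->
    (forall i, (P [set w | (T i w <> 0)%R] <= (L * n%:R `^ (-1 - eps))%:E)%E) ->
    ('E_P[fun w => injective_norm (centered T w)]
       <= (C * (L * r%:R ^+ 4 / eps))%:E)%E /\
    forall t : R, 0 < t ->
      (P [set w | (C * (L * r%:R ^+ 3 / eps) * (r%:R + t)
                     <= injective_norm (centered T w))%R]
         <= (n%:R `^ (- t))%:E)%E.
Proof.
(* Twice the constant 200 of the tail, because the expectation bound has [r + 2 <= 2 * r]. *)
exists 400; split=> [|n r eps n5 r2 e0 e1 hr d Omega P T L Tind T1 L1 Tp]; first by [].
have [l1 rn] := order_bounds n5 e0 e1 hr.
have n0 : (0 < n)%N by exact: leq_trans n5.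
have nE := @natr_expR_ln R n n0.
have powE (x : R) : n%:R `^ x = expR (x * ln n%:R) by rewrite /powR pnatr_eq0 gtn_eqF.
have {}Tp i : (P [set w | (T i w <> 0)%R] <= (L * expR ((-1 - eps) * ln n%:R))%:E)%E.
  by have := Tp i; rewrite powE.
have rR : 2 <= r%:R :> R by rewrite ler_nat.
have k0 : 0 <= L * r%:R ^+ 3 / eps.
  by rewrite divr_ge0 ?(ltW e0) // mulr_ge0 ?exprn_ge0 // (le_trans _ L1).
split.
  apply: le_trans (injective_norm_expectation n5 r2 rn l1 e0 e1 L1 Tind T1 nE erefl Tp) _.
  rewrite lee_fin.
  have -> : 400 * (L * r%:R ^+ 4 / eps) = 200 * (L * r%:R ^+ 3 / eps) * (r%:R + r%:R).
    by field; rewrite gt_eqF.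
  by apply: ler_wpM2l; [exact: mulr_ge0|rewrite lerD2l].
move=> t t0; have -> : n%:R `^ (- t) = expR (- ln n%:R * t).
  by rewrite powE; congr expR; ring.
apply: (injective_norm_tail n5 r2 rn l1 e0 e1 L1 Tind T1 nE erefl Tp t0).
by rewrite ler_wpM2r // ler_nat.
Qed.
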